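(* Assume that $u_0\in H^1_p=\{u\in H^1: u(x)=u(x+L)\}$. Then there is a constant $C>0$, independent of $t\in[0,T]$, of the mesh parameters $N,\tau$ and of the time level $n$, such that the exact solution $u$ of the periodic RLW problem $$u_t+au_x-\sigma u_{xxt}+\big(\tfrac{\gamma}{2}u^2\big)_x=0,\quad u(x,0)=u_0(x),\quad u(x,t)=u(x+L,t),\quad t\in[0,T],$$ satisfies $$\|u\|_0\le C,\qquad \|u_x\|_0\le C,\qquad \|u\|_\infty\le C\qquad (t\in[0,T]),$$ and any numerical solution $\mathbf{U}^0,\dots,\mathbf{U}^{N_t}\in\mathbb{R}^N$ of the LCN-MP scheme $$(\mathbb{I}-\sigma\mathbb{D}_2)\,\delta_t^+\mathbf{U}^n+\mathbb{D}\big(\widehat{\mathbf{U}}^{n+\frac12}\big)\mathbf{U}^{n+\frac12}=0\ (n\ge1),\qquad (\mathbb{I}-\sigma\mathbb{D}_2)\,\delta_t^+\mathbf{U}^0+\mathbb{D}\big(\mathbf{U}^{\frac12}\big)\mathbf{U}^{\frac12}=0,$$ with initial value $U^0_j=u_0(x_j)$, satisfies $$\|\mathbf{U}^n\|_h\le C,\qquad |\mathbf{U}^n|_h\le C,\qquad \|\mathbf{U}^n\|_{\infty,h}\le C\qquad(0\le n\le N_t).$$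
   Context: Constants: $a,\sigma,\gamma>0$, $T>0$. The space interval is $\Omega=[x_L,x_R]$, $L=x_R-x_L$. $\|\cdot\|_0$ is the $L^2(\Omega)$ norm in $x$ and $\|\cdot\|_\infty$ the $L^\infty(\Omega)$ norm in $x$ at a fixed time. The exact solution (real-valued) is understood as the $H^1_p$-valued solution, $u\in C^1([0,T];H^1_p)$, with the equation holding in the distributional sense in $x$. $N$ is a positive even integer, $h=L/N$, $x_j=x_L+jh$ for $0\le j\le N-1$, $\mu=2\pi/L$. Time step $\tau=T/N_t$ with $N_t$ a positive integer. Grid functions are vectors $\mathbf{U}=(U_0,\dots,U_{N-1})$, with $(\mathbf{U},\mathbf{V})_h=h\sum_{j=0}^{N-1}U_j\overline{V}_j$, $\|\mathbf{U}\|_h=\sqrt{(\mathbf{U},\mathbf{U})_h}$, $\|\mathbf{U}\|_{\infty,h}=\max_{0\le j\le N-1}|U_j|$. Fourier differentiation matrices: $g_j(x)=\frac1N\sum_{k=-N/2}^{N/2}\frac1{c_k}e^{ik\mu(x-x_j)}$ with $c_k=1$ for $|k|\ne N/2$ and $c_{\pm N/2}=2$; $(\mathbb{D}_k)_{jl}=\frac{d^k g_l}{dx^k}(x_j)$, $0\le j,l\le N-1$. $\mathbb{I}$ is the identity matrix. ($\mathbb{D}_1$ is real antisymmetric, $\mathbb{D}_2$ is real symmetric negative semi-definite.) Semi-norm: $|\mathbf{U}|_h=\sqrt{(-\mathbb{D}_2\mathbf{U},\mathbf{U})_h}$. $\mathbb{D}(\mathbf{U})=a\mathbb{D}_1+\frac{\gamma}{3}\big(\mathrm{diag}(\mathbf{U})\mathbb{D}_1+\mathbb{D}_1\mathrm{diag}(\mathbf{U})\big)$.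 Time notation: $\delta_t^+\mathbf{U}^n=\frac{\mathbf{U}^{n+1}-\mathbf{U}^n}{\tau}$, $\widehat{\mathbf{U}}^{n+\frac12}=\frac{3\mathbf{U}^n-\mathbf{U}^{n-1}}{2}$, $\mathbf{U}^{n+\frac12}=\frac{\mathbf{U}^{n+1}+\mathbf{U}^n}{2}$. *)

(* Defs.v *)
From HB Require Import structures.
From mathcomp Require Import all_boot all_order all_algebra.
From mathcomp Require Import complex.
From mathcomp Require Import all_classical all_reals all_analysis.

Set Implicit Arguments.
Unset Strict Implicit.
Unset Printing Implicit Defensive.

Import Order.TTheory GRing.Theory Num.Theory.
Import numFieldNormedType.Exports.

Local Open Scope classical_set_scope.
Local Open Scope ring_scope.

Section PeriodicSobolev.
Context {R : realType}.
Variables xL xR : R.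

Definition Omega_measure : {measure set (measurableTypeR R) -> \bar R} :=
  mrestr (@lebesgue_measure R) (measurable_itv `[xL, xR]).

Definition L2norm (f : R -> R) : \bar R :=
  'N[Omega_measure]_(2%:E)[EFin \o f]%E.

Definition Linfnorm (f : R -> R) : \bar R :=
  'N[Omega_measure]_(+oo)[EFin \o f]%E.

Definition test_function (phi : R -> R) : Prop :=
  (forall (n : nat) (x : R), derivable phi^`(n)%classic x 1) /\
  compact (closure [set x | phi x != 0]).

(* Borel functions on the whole line that are periodic and square integrable
   over one period; each class of L^2_p has such a representative. *)
Definition L2p (f : R -> R) : Prop :=
  [/\ measurable_fun [set: R] f,
      periodic f (xR - xL) &
      (L2norm f < +oo)%E].

Definition is_weak_derivative (f g : R -> R) : Prop :=
  forall phi : R -> R, test_function phi ->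
    \int[lebesgue_measure]_x (f x * phi^`()%classic x) =
    - \int[lebesgue_measure]_x (g x * phi x).

(* Elements of H^1_p are identified with their continuous representative, so
   that point values such as u_0(x_j) make sense. *)
Definition H1p (f : R -> R) : Prop :=
  [/\ continuous f, L2p f &
      exists2 g : R -> R, L2p g & is_weak_derivative f g].

(* Some representative of the weak derivative, which is unique up to null
   sets; the default value 0 is only taken when no weak derivative exists. *)
Definition weak_derivative (f : R -> R) : R -> R :=
  xget (fun=> 0) [set g | L2p g /\ is_weak_derivative f g].

Definition H1norm (f : R -> R) : \bar R :=
  ((L2norm f ^+ 2 + L2norm (weak_derivative f) ^+ 2) `^ 2^-1)%E.

(* u \in C^1([0,T]; H^1_p), with u' as its derivative: the difference quotients
   converge in H^1_p (one-sidedly at 0 and T), and u' is continuous into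
   H^1_p. *)
Definition C1_H1p (T : R) (u u' : R -> R -> R) : Prop :=
  forall t : R, t \in `[0, T] ->
    [/\ H1p (u t), H1p (u' t),
        H1norm (fun x => (u s x - u t x) / (s - t) - u' t x)
          @[s --> within `[0, T]%classic t^'] --> 0%E &
        H1norm (fun x => u' s x - u' t x)
          @[s --> within `[0, T]%classic (nbhs t)] --> 0%E].

(* At every time, u_t + a u_x - sigma u_xxt + (gamma/2 u^2)_x = 0 in D'(R):
   all x-derivatives are moved to the test function. *)
Definition RLW_exact_solution (a sigma gamma T : R) (u0 : R -> R)
    (u : R -> R -> R) : Prop :=
  exists2 ut : R -> R -> R, C1_H1p T u ut &
    (forall t : R, t \in `[0, T] ->
       forall phi : R -> R, test_function phi ->
         \int[lebesgue_measure]_x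
           (ut t x * phi x - a * u t x * phi^`()%classic x
            - sigma * ut t x * phi^`(2)%classic x
            - gamma / 2 * u t x ^+ 2 * phi^`()%classic x) = 0) /\
    (forall x : R, u 0 x = u0 x).

End PeriodicSobolev.

Section Grid.
Context {R : realType}.
Variables (xL xR : R) (N : nat).

Definition mesh : R := (xR - xL) / N%:R.

Definition node (j : nat) : R := xL + j%:R * mesh.

Definition dotg (U V : 'cV[R]_N) : R := mesh * \sum_(j < N) U j 0 * V j 0.

Definition normg (U : 'cV[R]_N) : R := Num.sqrt (dotg U U).

Definition normg_inf (U : 'cV[R]_N) : R :=
  \big[Num.max/0]_(j < N) `|U j 0|.

Definition expi (theta : R) : R[i] := (cos theta +i* sin theta)%C.

Definition fourier_weight (k : int) : R :=
  if `|k|%N == N./2 then 2 else 1.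

Definition fourier_mode (l : nat) (x : R) (k : int) : R[i] :=
  ((fourier_weight k)^-1)%:C%C *
  expi (k%:~R * (2 * pi / (xR - xL)) * (x - node l)).

(* The index m = 0, ..., N stands for the wave number k = m - N/2. *)
Definition fourier_basis (l : nat) (x : R) : R[i] :=
  (N%:R^-1)%:C%C *
  \sum_(m < N.+1) fourier_mode l x (m%:Z - (N./2)%:Z).

(* Only the real part of g_l is differentiated: g_l is real valued, see
   [fourier_basis_real] below. *)
Definition fourier_diff (k : nat) : 'M[R]_N :=
  \matrix_(j < N, l < N)
    (fun x => complex.Re (fourier_basis l x))^`(k)%classic (node j).

Definition seminormg (U : 'cV[R]_N) : R :=
  Num.sqrt (dotg (- (fourier_diff 2 *m U)) U).

Definition convection (a gamma : R) (U : 'cV[R]_N) : 'M[R]_N :=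
  let dU := diag_mx U^T in
  let D1 := fourier_diff 1 in
  a *: D1 + (gamma / 3) *: (dU *m D1 + D1 *m dU).

Definition LCN_MP_solution (a sigma gamma T : R) (Nt : nat) (u0 : R -> R)
    (U : nat -> 'cV[R]_N) : Prop :=
  let tau := T / Nt%:R in
  let dt n := tau^-1 *: (U n.+1 - U n) in
  let mid n := 2^-1 *: (U n.+1 + U n) in
  let extrap n := 2^-1 *: (3 *: U n - U n.-1) in
  let A := 1%:M - sigma *: fourier_diff 2 in
  [/\ U 0%N = \col_(j < N) u0 (node j),
      A *m dt 0%N + convection a gamma (mid 0%N) *m mid 0%N = 0 &
      forall n : nat, (1 <= n < Nt)%N ->
        A *m dt n + convection a gamma (extrap n) *m mid n = 0].

End Grid.

Lemma fourier_basis_real (R : realType) (xL xR : R) (N l : nat) (x : R) :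
  ~~ odd N -> complex.Im (fourier_basis xL xR N l x) = 0.
Proof.
move=> evenN.
have Fim (c : R) (z : R[i]) : complex.Im (c%:C%C * z) = c * complex.Im z.
  by case: z => p q /=; rewrite mul0r addr0.
rewrite /fourier_basis Fim raddf_sum.
set k := fun m : 'I_N.+1 => m%:Z - (N./2)%:Z.
set S := (X in _ * X).
have SE : S = \sum_m complex.Im (fourier_mode xL xR N l x (k m)) by [].
suff SN : S = - S.
  suff -> : S = 0 by rewrite mulr0.
  by have := mulrn_eq0 S 2; rewrite mulr2n {1}SN addNr eqxx => /esym/eqP.
rewrite SE {1}(reindex_inj rev_ord_inj) -sumrN; apply: eq_bigr => m _.
have -> : k (rev_ord m) = - k m.
  have mN : (m <= N)%N by rewrite -ltnS.
  rewrite /k /= subSS -subzn// opprB.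
  by rewrite -[in X in X%:Z - _](even_halfK evenN) -addnn PoszD addrAC addrK.
by rewrite /fourier_mode !Fim /= /fourier_weight abszN mulrNz !mulNr sinN mulrN.
Qed.

(* Main.v *)
Require Import Defs.
From HB Require Import structures.
From mathcomp Require Import all_boot all_order all_algebra.
From mathcomp Require Import complex.
From mathcomp Require Import all_classical all_reals all_analysis.
From mathcomp Require Import ring lra zify.
From mathcomp Require Import measurable_realfun ess_sup_inf.

(** Both problems conserve an energy, and both energies control the maximum norm.

    The continuous energy is the integral of u^2 + sigma u_x^2 over a period. Formally
    its time derivative is twice the equation tested with u, in which the terms
    a u_x u and (gamma/2 u^2)_x u integrate to 0. The equation holds only in the sense
    of distributions on the line, where u is not a test function, and u_t has only
    a weak derivative in x. The equation says, however, that
    G = sigma u_xt - a u - gamma/2 u^2 has the continuous weak derivative u_t.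
    Smooth cutoffs of intervals then show that G is an antiderivative of u_t almost
    everywhere ([weak_derivative_primitive]), and the product rule for absolutely
    continuous functions ([primitiveM]) justifies the integration by parts
    ([energy_identity]). Since difference quotients in time converge in H^1, the
    energy has derivative 0 and is constant ([energy_conservation]). The Sobolev
    inequality [H1p_sup] gives the maximum norm.

    The discrete energy ||U||_h^2 + sigma |U|_h^2 is conserved from one time level to
    the next because the first Fourier differentiation matrix is antisymmetric, the
    second is symmetric, and the nonlinear term is split so that it stays
    antisymmetric ([step_conservation]). What depends on the mesh is the energy of
    the interpolated initial value, and the Sobolev inequality on the grid. Both
    reduce to finite differences: the spectral seminorm |U|_h is equivalent to the
    l^2 norm of the difference quotients, with constants that do not depend on N,
    because 4 sin^2(t) and 4 t^2 are comparable on [-pi/2, pi/2] ([sqdiff_bounds]).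
    Finite differences of u_0 are bounded by its weak derivative through the
    Cauchy-Schwarz inequality on each cell ([sqdiff_sample]). *)

Set Implicit Arguments.
Unset Strict Implicit.
Unset Printing Implicit Defensive.

Import Order.TTheory GRing.Theory Num.Theory.
Import numFieldNormedType.Exports.

Local Open Scope ring_scope.

(** * Integrals over segments *)

Section SegmentIntegral.
Context {R : realType}.
Local Notation mu := (@lebesgue_measure R).
Implicit Types (f g : R -> R) (a b c x y z : R).
Local Open Scope classical_set_scope.

Definition locint f := locally_integrable [set: R] f.

Lemma locint_measurable f : locint f -> measurable_fun [set: R] f.
Proof. by case. Qed.

Lemma locint_itv f a b : locint f -> mu.-integrable `[a, b] (EFin \o f).
Proof.
case=> mf _ /(_ `[a, b] (@subsetT _ _) (@segment_compact _ a b)) foo.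
apply/integrableP; split; last exact: foo.
by apply/measurable_EFinP; exact: measurable_funS mf.
Qed.

Lemma itv_locint f : measurable_fun [set: R] f ->
  (forall a b, mu.-integrable `[a, b] (EFin \o f)) -> locint f.
Proof.
move=> mf fi; split => //; first exact: openT.
move=> K _ cK; have [M [Mr MK]] := compact_bounded cK.
have {MK} : forall x, K x -> `|x| <= M + 1 by move=> x; apply: MK; rewrite ltrDl.
move=> MK; have /integrableP[_] := fi (- (M + 1)) (M + 1).
apply: le_lt_trans; apply: ge0_subset_integral => //=.
- exact: compact_measurable.
- apply/measurable_EFinP; apply: measurableT_comp => //.
  exact: measurable_funS mf.
- by move=> x /MK; rewrite /= in_itv/= ler_norml.
Qed.

Lemma continuous_locint f : continuous f -> locint f.
Proof.
move=> cf; apply: itv_locint; first exact: continuous_measurable_fun.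
move=> a b; apply: continuous_compact_integrable; first exact: segment_compact.
exact: continuous_subspaceT.
Qed.

(** A continuous factor is bounded on every segment. *)
Lemma locintM f g : continuous f -> locint g -> locint (f \* g).
Proof.
move=> cf lg; have mf := continuous_measurable_fun cf.
apply: itv_locint.
  by apply: measurable_funM => //; exact: locint_measurable.
move=> a b; have : mu.-integrable `[a, b] ((EFin \o f) \* (EFin \o g))%E.
  apply: integrableMr => //; first exact: measurable_funS mf.
    have : compact (f @` `[a, b]).
      apply: continuous_compact; first exact: continuous_subspaceT.
      exact: segment_compact.
    move=> /compact_bounded [M [Mr MK]]; exists M; split => // y /MK My x xab.
    by apply: My; exists x.
  exact: locint_itv.
by apply: eq_integrable.
Qed.

Lemma locintD f g : locint f -> locint g -> locint (f \+ g).
Proof. exact: locally_integrableD. Qed.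

Lemma locintB f g : locint f -> locint g -> locint (f \- g).
Proof. exact: locally_integrableB. Qed.

Lemma locintZ k f : locint f -> locint (fun x => k * f x).
Proof. by move=> lf; apply: (locintM (f := cst k)) => // ?; exact: cvg_cst. Qed.

Lemma locint_norm f : locint f -> locint (fun x => `|f x|).
Proof.
move=> lf; apply: itv_locint.
  by apply: measurableT_comp => //; exact: locint_measurable.
by move=> a b; exact: (integrable_norm (locint_itv a b lf)).
Qed.

(** When [b < a] this is 0, not minus the integral over [b, a]. *)
Definition sint f a b : R := \int[mu]_(x in `[a, b]) f x.

Lemma eq_sint f g a b : (forall x, a <= x <= b -> f x = g x) ->
  sint f a b = sint g a b.
Proof.
by move=> fg; apply: eq_Rintegral => x; rewrite inE/= in_itv/=; exact: fg.
Qed.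

Lemma sint_split f a b c : locint f -> a <= b -> b <= c ->
  sint f a c = sint f a b + sint f b c.
Proof.
move=> lf ab bc; have := @Rintegral_itvB _ f (BLeft a) (BRight c) b.
rewrite !bnd_simp => /(_ (locint_itv _ _ lf) ab bc) H.
rewrite /sint -(@Rintegral_itv_obnd_cbnd _ b) ?H; last first.
  apply: integrableS (locint_itv b c lf) => //.
  by apply: subset_itvr; rewrite bnd_simp.
by rewrite -H; ring.
Qed.

Lemma sintD f g a b : locint f -> locint g ->
  sint (f \+ g) a b = sint f a b + sint g a b.
Proof. by move=> lf lg; rewrite /sint RintegralD//; exact: locint_itv. Qed.

Lemma sintB f g a b : locint f -> locint g ->
  sint (f \- g) a b = sint f a b - sint g a b.
Proof. by move=> lf lg; rewrite /sint RintegralB//; exact: locint_itv. Qed.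

Lemma sintZ k f a b : locint f ->
  sint (fun x => k * f x) a b = k * sint f a b.
Proof. by move=> lf; rewrite /sint RintegralZl//; exact: locint_itv. Qed.

Lemma sint_cst k a b : a <= b -> sint (fun=> k) a b = k * (b - a).
Proof.
move=> ab; rewrite /sint Rintegral_cst//= lebesgue_measure_itv/= lte_fin.
move: ab; rewrite le_eqVlt => /predU1P[->|ab]; last by rewrite ab.
by rewrite ltxx subrr mulr0.
Qed.

Lemma le_sint f g a b : locint f -> locint g ->
  (forall x, a <= x <= b -> f x <= g x) -> sint f a b <= sint g a b.
Proof.
by move=> lf lg fg; apply: le_Rintegral => //; exact: locint_itv.
Qed.

Lemma sint_ge0 f a b : (forall x, 0 <= f x) -> 0 <= sint f a b.
Proof. by move=> f0; exact: Rintegral_ge0. Qed.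

Lemma le_norm_sint f a b : locint f ->
  `|sint f a b| <= sint (fun x => `|f x|) a b.
Proof. by move=> lf; apply: le_normr_Rintegral => //; exact: locint_itv. Qed.

Lemma sint_point f a : sint f a a = 0.
Proof. by rewrite /sint set_itv1 Rintegral_set1. Qed.

End SegmentIntegral.

(** * A smooth bump *)

Section Smooth.
Context {R : realType}.
Implicit Types (f g : R -> R) (a b c x y z : R).
Local Open Scope classical_set_scope.

(** For functions whose increments are estimated rather than computed: [flat] at
    the edge of its support, and the energy as a function of time. *)
Lemma is_derive_of_bound f x d :
  (forall e, 0 < e -> exists2 r, 0 < r &
     forall y, `|y - x| < r -> `|f y - f x - d * (y - x)| <= e * `|y - x|) ->
  is_derive x 1 f d.
Proof.
move=> H.
suff C : h^-1 *: ((f \o shift x) (h *: (1 : R)) - f x) @[h --> 0^'] --> d.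
  by apply: DeriveDef; [exact: (cvgP d)|exact: cvg_lim].
apply/cvgrPdist_le => e e0; have [r r0 Hr] := H _ e0.
near=> h.
have h0 : h != 0 by near: h; exact: nbhs_dnbhs_neq.
have hr : `|h| < r by near: h; exact: dnbhs0_lt.
have := Hr (h + x); rewrite addrK => /(_ hr).
rewrite -ler_pdivrMr ?normr_gt0//; apply: le_trans.
rewrite -normrV ?unitfE// -normrM -normrN /= /GRing.scale/= mulr1.
by rewrite le_eqVlt; apply/orP; left; apply/eqP; congr `|_|; field.
Unshelve. all: by end_near. Qed.

Lemma is_derive_derive1 f x d : is_derive x 1 f d -> f^`() x = d.
Proof. by move=> H; rewrite derive1E (derive_val (is_derive := H)). Qed.

Lemma is_derive_derivable f x d : is_derive x 1 f d -> derivable f x 1.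
Proof. by case. Qed.

Lemma is_derive_continuous f (df : R -> R) :
  (forall x, is_derive x 1 f (df x)) -> continuous f.
Proof.
move=> H x; apply: differentiable_continuous; apply/derivable1_diffP.
exact: is_derive_derivable (H x).
Qed.

Definition smooth f := forall n x, derivable f^`(n) x 1.

Lemma smooth_derive f : smooth f -> smooth f^`().
Proof.
move=> sf n x; rewrite /derive1n -iterSr; exact: (sf n.+1).
Qed.

Lemma smooth_is_derive f x : smooth f -> is_derive x 1 f (f^`() x).
Proof. by move=> /(_ 0%N x) d; apply: DeriveDef => //; rewrite derive1E. Qed.

Lemma smooth_antiderivative f g :
  (forall x, is_derive x 1 f (g x)) -> smooth g -> smooth f.
Proof.
move=> fg sg [|n] x; first exact: is_derive_derivable (fg x).
have -> : f^`(n.+1) = g^`(n); last exact: sg.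
rewrite /derive1n iterSr; congr (iter n _ _); apply/funext => z.
exact: is_derive_derive1 (fg z).
Qed.

Lemma smooth_continuous f : smooth f -> continuous f.
Proof.
by move=> sf; apply: (@is_derive_continuous f f^`()) => x; exact: smooth_is_derive.
Qed.

Lemma smooth_linear_comp f g k1 k2 k a b : smooth f -> smooth g ->
  smooth (fun x => k1 * f (k * (x - a)) + k2 * g (k * (x - b))).
Proof.
move=> sf sg.
have aff c (y : R) : is_derive y 1 (fun x => k * (x - c)) k.
  have -> : (fun x => k * (x - c)) = (k *: (@id R - cst c)) by apply/funext.
  by apply: is_derive_eq; rewrite subr0 /GRing.scale/= mulr1.
have D (f1 f2 : R -> R) (j1 j2 x : R) : smooth f1 -> smooth f2 ->
    is_derive x 1 (fun x => j1 * f1 (k * (x - a)) + j2 * f2 (k * (x - b)))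
      (j1 * k * f1^`()%classic (k * (x - a)) + j2 * k * f2^`()%classic (k * (x - b))).
  move=> s1 s2.
  have C (h : R -> R) c : smooth h ->
      is_derive x 1 (h \o (fun x => k * (x - c))) (k * h^`()%classic (k * (x - c))).
    move=> sh; rewrite mulrC; apply: is_derive1_comp.
    exact: smooth_is_derive.
  have C1 := C _ a s1; have C2 := C _ b s2.
  have := is_deriveD (is_deriveZ j1 C1) (is_deriveZ j2 C2).
  by rewrite /GRing.scale/= !mulrA; apply.
have F n : exists j1 j2, (fun x => k1 * f (k * (x - a)) + k2 * g (k * (x - b)))^`(n)
    = (fun x => j1 * f^`(n)%classic (k * (x - a)) + j2 * g^`(n)%classic (k * (x - b))).
  elim: n => [|n [j1 [j2 IH]]]; first by exists k1, k2.
  exists (j1 * k), (j2 * k); rewrite /derive1n iterS -/(derive1n n _) IH.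
  apply/funext => x; apply: is_derive_derive1.
  by apply: D => m z; rewrite /derive1n -iterD; [exact: (sf (m + n)%N)|exact: (sg (m + n)%N)].
move=> n x; have [j1 [j2 ->]] := F n.
by apply: is_derive_derivable; apply: D => m z; rewrite /derive1n -iterD;
  [exact: (sf (m + n)%N)|exact: (sg (m + n)%N)].
Qed.

(** Smoothness of p s^-k exp(-1/s), extended by 0 where s <= 0, is proved for all
    [p] and [k] at once because this class is closed under differentiation. *)
Definition flat (s p : {poly R}) (k : nat) : R -> R :=
  fun x => if 0 < s.[x] then p.[x] * s.[x]^-1 ^+ k * expR (- s.[x]^-1) else 0.

(** This is e^x >= x^(n+1) / (n+1)! at x = 1/t. *)
Lemma expR_decay (t : R) n : 0 < t -> t^-1 ^+ n * expR (- t^-1) <= n.+1`!%:R * t.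
Proof.
move=> t0; have ti : 0 < t^-1 by rewrite invr_gt0.
have -> : t^-1 ^+ n * expR (- t^-1) = t^-1 ^+ n.+1 * expR (- t^-1) * t.
  by rewrite exprS; field; rewrite gt_eqF.
rewrite ler_pM2r// expRN ler_pdivrMr ?expR_gt0//.
rewrite mulrC -ler_pdivrMr ?ltr0n ?fact_gt0//.
by rewrite (le_trans _ (expR_ge1Dxn n (ltW ti)))// lerDr.
Qed.

Lemma poly_bounded_near (p : {poly R}) x : exists2 M, 0 < M &
  \forall y \near x, `|p.[y]| <= M.
Proof.
exists (`|p.[x]| + 1); first by rewrite ltr_wpDl.
have := @continuous_horner R p x => /cvgrPdist_le /(_ 1 ltr01).
apply: filterS => y Hy; rewrite addrC -lerBlDr.
by apply: le_trans (lerB_dist _ _) _; rewrite distrC.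
Qed.

(** Where s > 0 this is the product rule. If s(x) <= 0, then s(y) is at most a
    multiple of |y - x| near x, and s^-k exp(-1/s) is at most a multiple of s^2
    where s > 0, so the function is O(|y - x|^2) and its derivative is 0. *)
Lemma is_derive_flat (s p : {poly R}) k x :
  is_derive x 1 (flat s p k)
    (flat s (p^`() * s ^+ 2 - p * s^`() * s *+ k + p * s^`())%R k.+2 x).
Proof.
have [sx|sx] := ltP 0 s.[x].
  have H : \forall y \near x, p.[y] * s.[y]^-1 ^+ k * expR (- s.[y]^-1) = flat s p k y.
    have := @continuous_horner R s x => /cvgrPdist_lt /(_ _ sx).
    apply: filterS => y; rewrite /flat => Hy.
    rewrite ifT//; have := ler_norm (s.[x] - s.[y]); lra.
  apply: (near_eq_is_derive H).
  have dp := is_derive_poly p x; have ds := is_derive_poly s x.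
  have s0 : s.[x] != 0 by rewrite gt_eqF.
  have dv := is_deriveV s0 ds.
  have dX := is_deriveX k dv.
  have dN := is_deriveN dv.
  have dE : is_derive x 1 (expR \o (fun y => - s.[y]^-1))
      (expR (- s.[x]^-1) * - (- s.[x] ^- 2 *: s^`().[x])).
    by apply: is_derive1_comp.
  have := is_deriveM (is_deriveM dp dX) dE.
  have -> : (horner p * (fun y => s.[y]^-1) ^+ k * (expR \o (fun y => - s.[y]^-1))) =
      (fun y => p.[y] * s.[y]^-1 ^+ k * expR (- s.[y]^-1)).
    by apply/funext => y; rewrite !fctE.
  move=> /is_derive_eq; apply.
  rewrite /flat sx !fctE !(hornerD, hornerN, hornerM, hornerMn) /GRing.scale/=.
  have -> : k%:R * s.[x]^-1 ^+ k.-1 = k%:R * s.[x]^-1 ^+ k * s.[x].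
    by case: k {H dX} => [|k]; rewrite ?mul0r//= exprS; field.
  rewrite -mulr_natr !exprS expr0.
  by move: (s.[x]^-1 ^+ k) => w; field.
have [Mp Mp0 Hp] := poly_bounded_near p x.
have [q qE] : exists q, s - s.[x]%:P = q * ('X - x%:P).
  by apply/factor_theorem; rewrite /root !hornerE subrr.
have [Mq Mq0 Hq] := poly_bounded_near q x.
have {}qE y : s.[y] - s.[x] = q.[y] * (y - x).
  by have /(congr1 (fun t => t.[y])) := qE; rewrite !hornerE.
have -> : flat s (p^`() * s ^+ 2 - p * s^`() * s *+ k + p * s^`())%R k.+2 x = 0.
  by rewrite /flat ltNge sx.
apply: is_derive_of_bound => e e0.
set K := Mp * k.+2`!%:R * Mq ^+ 2.
have K0 : 0 < K by rewrite !mulr_gt0 ?exprn_gt0 ?ltr0n ?fact_gt0.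
have /nbhs_ballP[r/= r0 Hr] : \forall y \near x, `|p.[y]| <= Mp /\ `|q.[y]| <= Mq.
  by apply: filterS2 Hp Hq.
exists (Num.min r (e / K)); first by rewrite lt_min r0 divr_gt0.
move=> y; rewrite lt_min => /andP[yr ye].
have [py qy] : `|p.[y]| <= Mp /\ `|q.[y]| <= Mq by apply: Hr; rewrite /ball/= distrC.
rewrite mul0r subr0 [flat s p k x]/flat (ltNge _ s.[x]) sx/= subr0 /flat.
have [sy|_] := ltP 0 s.[y]; last by rewrite normr0 mulr_ge0// ltW.
have sle : s.[y] <= Mq * `|y - x|.
  have : s.[y] <= s.[y] - s.[x] by rewrite lerDl oppr_ge0.
  move/le_trans; apply; rewrite qE (le_trans (ler_norm _))// normrM.
  by rewrite ler_wpM2r.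
have E2 : s.[y]^-1 ^+ k * expR (- s.[y]^-1) <= k.+2`!%:R * s.[y] ^+ 2.
  have -> : s.[y]^-1 ^+ k * expR (- s.[y]^-1) = s.[y]^-1 ^+ k.+1 * expR (- s.[y]^-1) * s.[y].
    by rewrite exprS; field; rewrite gt_eqF.
  by rewrite expr2 mulrA ler_pM2r// expR_decay.
rewrite -mulrA normrM (ger0_norm (x := _ * expR _)); last first.
  by rewrite mulr_ge0 ?expR_ge0// exprn_ge0// invr_ge0 ltW.
apply: (@le_trans _ _ (Mp * (k.+2`!%:R * (Mq * `|y - x|) ^+ 2))).
  apply: ler_pM => //; first by rewrite mulr_ge0 ?expR_ge0// exprn_ge0// invr_ge0 ltW.
  apply: le_trans E2 _; rewrite ler_pM2l ?ltr0n ?fact_gt0//.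
  by rewrite ler_pXn2r// nnegrE ?mulr_ge0// ltW.
have -> : Mp * (k.+2`!%:R * (Mq * `|y - x|) ^+ 2) = (K * `|y - x|) * `|y - x|.
  by rewrite /K; ring.
by rewrite ler_wpM2r// mulrC -ler_pdivlMr// ltW.
Qed.

Lemma smooth_flat (s p : {poly R}) k : smooth (flat s p k).
Proof.
have F n : exists p' k', (flat s p k)^`(n)%classic = flat s p' k'.
  elim: n => [|n [p' [k' IH]]]; first by exists p, k.
  exists (p'^`() * s ^+ 2 - p' * s^`() * s *+ k' + p' * s^`())%R, k'.+2.
  rewrite /derive1n iterS -/(derive1n n _) IH; apply/funext => x.
  exact: is_derive_derive1 (is_derive_flat _ _ _ _).
move=> n x; have [p' [k' ->]] := F n.
exact: is_derive_derivable (is_derive_flat _ _ _ _).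
Qed.

Definition bump : R -> R := flat ('X * (1 - 'X)) 1 0.

Lemma bumpE x : bump x =
  if 0 < x * (1 - x) then expR (- (x * (1 - x))^-1) else 0.
Proof. by rewrite /bump /flat !hornerE. Qed.

Lemma bump_ge0 x : 0 <= bump x.
Proof. by rewrite bumpE; case: ifP; rewrite ?expR_ge0. Qed.

Lemma bump_le1 x : bump x <= 1.
Proof.
rewrite bumpE; case: ifP => // h.
by rewrite -[leRHS]expR0 ler_expR oppr_le0 invr_ge0 ltW.
Qed.

Lemma bump_out x : x <= 0 \/ 1 <= x -> bump x = 0.
Proof. by move=> h; rewrite bumpE ifF//; apply/negbTE; rewrite -leNgt; nra. Qed.

Lemma smooth_bump : smooth bump. Proof. exact: smooth_flat. Qed.

Lemma continuous_bump : continuous bump.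
Proof. exact: smooth_continuous smooth_bump. Qed.

Definition bump_mass : R := sint bump 0 1.

(** On [1/4, 3/4] the bump is at least exp(-8). *)
Lemma bump_mass_gt0 : 0 < bump_mass.
Proof.
have lb := continuous_locint continuous_bump.
have e1 : sint bump 0 1 = sint bump 0 4^-1 + sint bump 4^-1 1.
  by apply: sint_split => //; lra.
have e2 : sint bump 4^-1 1 = sint bump 4^-1 (3/4) + sint bump (3/4) 1.
  by apply: sint_split => //; lra.
rewrite /bump_mass e1 e2.
have h1 := sint_ge0 0 (4^-1) bump_ge0; have h2 := sint_ge0 (3/4) 1 bump_ge0.
have : sint (fun=> expR (- 8)) (4^-1) (3/4) <= sint bump (4^-1) (3/4).
  apply: le_sint => //; first by apply: continuous_locint => z; exact: cvg_cst.
  move=> x hx; rewrite bumpE ifT; last by nra.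
  rewrite ler_expR lerN2 -[leRHS]invrK lef_pV2 ?posrE ?invr_gt0//; nra.
rewrite sint_cst; last by lra.
have := expR_gt0 (- 8 : R); nra.
Qed.

End Smooth.

(** * The du Bois-Reymond lemma *)

Section WeakDerivative.
Context {R : realType}.
Local Notation mu := (@lebesgue_measure R).
Implicit Types (f g : R -> R) (a b c x y z : R).
Local Open Scope classical_set_scope.

Lemma sint_eq0 f a b : (forall x, a <= x <= b -> f x = 0) -> sint f a b = 0.
Proof.
move=> f0; rewrite (eq_sint (g := fun=> 0))//.
by rewrite /sint Rintegral_cst// mul0r.
Qed.

Lemma Rintegral_support f a b :
  (forall x, x < a -> f x = 0) -> (forall x, b < x -> f x = 0) ->
  \int[mu]_x f x = sint f a b.
Proof.
move=> fa fb; rewrite /sint [RHS]Rintegral_mkcond; congr (Rintegral _ _ _).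
apply/funext => x; rewrite /patch; case: ifPn => //.
rewrite notin_setE/= in_itv/= => /negP; rewrite negb_and -!ltNge => /orP[/fa|/fb] //.
Qed.

Lemma integrable_support f a b : locint f ->
  (forall x, x < a -> f x = 0) -> (forall x, b < x -> f x = 0) ->
  mu.-integrable [set: R] (EFin \o f).
Proof.
move=> lf fa fb; 
have := locint_itv a b lf => /integrable_mkcond -/(_ (measurable_itv _)).
congr (is_true (integrable _ _ _)).
apply/funext => x; rewrite /patch; case: ifPn => //.
rewrite notin_setE/= in_itv/= => /negP; rewrite negb_and -!ltNge.
by move=> /orP[/fa|/fb] ->.
Qed.

Lemma sint_is_derive f (df : R -> R) a b : a <= b ->
  (forall x, is_derive x 1 f (df x)) -> continuous df ->
  sint df a b = f b - f a.
Proof.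
move=> + fd cdf; rewrite le_eqVlt => /predU1P[<-|ab].
  by rewrite sint_point subrr.
have cf := is_derive_continuous fd.
rewrite /sint /Rintegral (@continuous_FTC2 _ df f a b ab)//.
- exact: continuous_subspaceT.
- split; first by move=> z _; exact: is_derive_derivable (fd z).
  + by apply: cvg_at_right_filter; exact: cf.
  + by apply: cvg_at_left_filter; exact: cf.
- by move=> z _; exact: is_derive_derive1 (fd z).
Qed.

(** A smooth transition from 0 to 1 over [0, 1]; the base point -1 only has to lie
    to the left of the support of the bump. *)
Definition step x : R := bump_mass^-1 * sint bump (-1) x.

Lemma is_derive_step x : is_derive x 1 step (bump_mass^-1 * bump x).
Proof.
suff H : is_derive x 1 (fun y : R => sint bump (-1) y) (bump x).
  exact: (is_deriveZ bump_mass^-1 H).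
have [x0|x0] := ltP x 0.
  rewrite bump_out; last by left; exact: ltW.
  have H : \forall y \near x, (cst 0 : R -> R) y = sint bump (-1) y.
    near=> y; have y0 : y < 0 by near: y; exact: lt_nbhsl.
    rewrite sint_eq0// => z /andP[_ zy]; apply: bump_out; left.
    exact: le_trans zy (ltW y0).
  by apply: (near_eq_is_derive H).
have xu : x < x + 1 by rewrite ltrDl.
have ax : -1 < x by lra.
have [D E] := continuous_FTC1_closed xu
  (locint_itv (-1) (x + 1) (continuous_locint (@continuous_bump R))) ax
  (@continuous_bump R x).
by apply: DeriveDef => //; rewrite -derive1E.
Unshelve. all: by end_near. Qed.

Lemma smooth_step : smooth step.
Proof.
apply: smooth_antiderivative is_derive_step _.
have -> : (fun x : R => bump_mass^-1 * bump x) =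
    (fun x => bump_mass^-1 * bump (1 * (x - 0)) + 0 * bump (1 * (x - 0))).
  by apply/funext => x; rewrite mul1r subr0 mul0r addr0.
by apply: smooth_linear_comp; exact: smooth_bump.
Qed.

Lemma step_le0 x : x <= 0 -> step x = 0.
Proof.
move=> x0; rewrite /step sint_eq0 ?mulr0// => z /andP[_ zx].
by apply: bump_out; left; exact: le_trans x0.
Qed.

Lemma step_split x y : -1 <= x -> x <= y ->
  step y = step x + bump_mass^-1 * sint bump x y.
Proof.
move=> x1 xy; rewrite /step -mulrDr; congr (_ * _).
by apply: sint_split => //; exact: continuous_locint continuous_bump.
Qed.

Lemma step_ge1 x : 1 <= x -> step x = 1.
Proof.
move=> x1.
have e1 : step x = step 1 + bump_mass^-1 * sint bump 1 x.
  by apply: step_split => //; lra.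
have e2 : step 1 = step 0 + bump_mass^-1 * sint bump 0 1.
  by apply: step_split => //; lra.
rewrite e1 e2 step_le0// (@sint_eq0 _ 1 x) => [|z /andP[z1 _]]; last first.
  by apply: bump_out; right.
by rewrite add0r mulr0 addr0 mulVf// gt_eqF// bump_mass_gt0.
Qed.

Lemma step_bound x : 0 <= step x <= 1.
Proof.
have m0 : 0 <= bump_mass^-1 :> R by rewrite invr_ge0 ltW// bump_mass_gt0.
have s0 y z : 0 <= bump_mass^-1 * sint bump y z.
  by apply: mulr_ge0 => //; apply: sint_ge0; exact: bump_ge0.
rewrite s0/=; have [x0|x0] := leP x 0; first by rewrite step_le0.
have [x1|x1] := leP 1 x; first by rewrite step_ge1.
have := @step_split x 1; rewrite (step_ge1 (lexx 1)) => -> //; last exact: ltW.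
- by rewrite lerDl.
- lra.
Qed.

(** A test function that tends to the indicator of [x, y] as k grows: both of its
    transitions have width 1/k. *)
Definition plateau (x y k : R) : R -> R :=
  fun z => step (k * (z - x)) - step (k * (z - y)).

(** The derivative of one transition, an approximate Dirac mass at [x]. *)
Definition plateau' (x k : R) : R -> R :=
  fun z => k * bump_mass^-1 * bump (k * (z - x)).

Lemma is_derive_plateau' x k z :
  is_derive z 1 (fun z => step (k * (z - x))) (plateau' x k z).
Proof.
have aff : is_derive z 1 (fun z => k * (z - x)) k.
  have -> : (fun z => k * (z - x)) = (k *: (@id R - cst x)) by apply/funext.
  by apply: is_derive_eq; rewrite subr0 /GRing.scale/= mulr1.
have := @is_derive1_comp _ step (fun z => k * (z - x)) z _ _ (is_derive_step _) aff.
by move=> /is_derive_eq; apply; rewrite /plateau'; ring.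
Qed.

Lemma derive_plateau x y k :
  (plateau x y k)^`()%classic = fun z => plateau' x k z - plateau' y k z.
Proof.
apply/funext => z; apply: is_derive_derive1.
have := is_deriveB (is_derive_plateau' x k z) (is_derive_plateau' y k z).
exact.
Qed.

Lemma plateau_out x y k z : x <= y -> 1 <= k -> (z <= x \/ y + 1 <= z) ->
  plateau x y k z = 0.
Proof.
move=> xy k1 [zx|zy]; rewrite /plateau.
  by rewrite !step_le0 ?subrr// mulr_ge0_le0//; lra.
have kz t : t <= y -> 1 <= k * (z - t).
  by move=> ty; rewrite -[leLHS]mulr1 ler_pM//; lra.
by rewrite !step_ge1 ?subrr//; apply: kz.
Qed.

Lemma test_function_plateau x y k : x <= y -> 1 <= k ->
  test_function (plateau x y k).
Proof.
move=> xy k1; split.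
  have -> : plateau x y k =
      (fun z => 1 * step (k * (z - x)) + (-1) * step (k * (z - y))).
    by apply/funext => z; rewrite mul1r mulN1r.
  by apply: smooth_linear_comp; exact: smooth_step.
apply: (subclosed_compact _ (@segment_compact _ x (y + 1))).
  exact: closed_closure.
have -> : `[x, y + 1] = closure `[x, y + 1].
  by rewrite -(closure_id `[x, y + 1]).1//; exact: interval_closed.
apply: closureS => z /=; rewrite in_itv/=; apply: contraNP.
by move=> /negP; rewrite negb_and -!ltNge => /orP[/ltW h|/ltW h];
  rewrite plateau_out//; [left|right].
Qed.

Lemma continuous_plateau' x k : continuous (plateau' x k).
Proof.
move=> z; apply: cvgM; first exact: cvg_cst.
apply: (@continuous_comp _ _ _ (fun z => k * (z - x)) bump).
  by apply: cvgM; [exact: cvg_cst|apply: cvgB => //; exact: cvg_cst].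
exact: continuous_bump.
Qed.

Lemma plateau'_ge0 x k z : 0 <= k -> 0 <= plateau' x k z.
Proof.
by move=> k0; rewrite !mulr_ge0 ?bump_ge0// invr_ge0 ltW// bump_mass_gt0.
Qed.

Lemma plateau'_le x k z : 0 <= k -> plateau' x k z <= k * bump_mass^-1.
Proof.
move=> k0; rewrite ler_piMr ?bump_le1// mulr_ge0// invr_ge0 ltW//.
exact: bump_mass_gt0.
Qed.

(** [x, x + r] lies in the ball of radius 2r about [x], whose measure is 4r, so
    one-sided means are controlled by the centred means that define Lebesgue
    points. *)
Lemma lebesgue_pt_sint f x : locint f -> lebesgue_pt f x ->
  forall e, 0 < e -> exists2 d, 0 < d &
    forall r, 0 < r -> r < d -> sint (fun z => `|f z - f x|) x (x + r) <= e * r.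
Proof.
move=> lf fx e e0.
have e4 : 0 < e / 4 by rewrite divr_gt0.
have : \forall r \near 0^'+, (davg f x r < (e / 4)%:E)%E.
  move: fx => /fine_cvgP[Hf /cvgrPdist_lt/(_ _ e4) Hd].
  near=> r; have rf : davg f x r \is a fin_num by near: r.
  have : `|0 - (fine \o davg f x) r| < e / 4 by near: r.
  rewrite /= sub0r normrN -[davg _ _ _]fineK// lte_fin fineK//.
  by apply: le_lt_trans; exact: ler_norm.
move=> /nbhs_ballP[d/= d0 Hd]; exists (d / 2); first by rewrite divr_gt0.
move=> r r0 rd.
have {Hd} : (davg f x (2 * r) < (e / 4)%:E)%E.
  apply: Hd; last by rewrite mulr_gt0.
  by rewrite /ball/= sub0r normrN gtr0_norm ?mulr_gt0//; lra.
have r20 : 0 <= 2 * r by rewrite mulr_ge0// ltW.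
rewrite /davg /iavg (lebesgue_measure_ball x r20).
have r40 : (2 * r) *+ 2 != 0 by rewrite mulrn_eq0/= mulf_neq0// gt_eqF.
rewrite inver (negbTE r40) muleC lte_pdivrMr; last by rewrite mulrn_wgt0// mulr_gt0.
have lfx : locint (fun z => `|f z - f x|).
  by apply: locint_norm; apply: locintB => //; apply: continuous_locint => z; exact: cvg_cst.
move=> H; rewrite -lee_fin /sint /Rintegral fineK; last first.
  exact: integrable_fin_num (locint_itv _ _ lfx).
have -> : e * r = e / 4 * ((2 * r) *+ 2) by rewrite -mulr_natr; field.
apply: le_trans (ltW H); rewrite [leRHS](_ : _ =
    (\int[lebesgue_measure]_(z in ball x (2 * r)) (`|f z - f x|)%:E)%E); last by [].
apply: ge0_subset_integral => //.
- exact: measurable_ball.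
- apply/measurable_EFinP; apply: measurable_funS (locint_measurable lfx) => //.
- move=> z /=; rewrite in_itv/= => /andP[xz zx].
  by rewrite /ball/= ler0_norm; lra.
Unshelve. all: by end_near. Qed.


Lemma plateau'_out x k z : 0 < k -> (z < x \/ x + k^-1 < z) -> plateau' x k z = 0.
Proof.
move=> k0 zx; rewrite /plateau' bump_out ?mulr0//; case: zx => zx; [left|right].
  by rewrite pmulr_rle0// subr_le0 ltW.
by rewrite -(@ler_pM2l _ k^-1) ?invr_gt0// mulrA mulVf ?gt_eqF//; lra.
Qed.

(** The kernel has mass 1, lives on [x, x + 1/k] and is at most a constant times
    k, so the error is at most a constant times the mean of |f - f(x)| there. *)
Lemma mollification_cvg f x : locint f -> lebesgue_pt f x ->
  (fun n => \int[mu]_z (f z * plateau' x n.+1%:R z)) @ \oo --> f x.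
Proof.
move=> lf fx; apply/cvgrPdist_le => e e0.
have m0 := @bump_mass_gt0 R.
have [|d d0 Hd] := lebesgue_pt_sint lf fx (e := e * bump_mass); first by rewrite mulr_gt0.
near=> n.
have k0 : 0 < n.+1%:R :> R by rewrite ltr0n.
have ki0 : 0 < (n.+1%:R)^-1 :> R by rewrite invr_gt0.
have nd : (n.+1%:R)^-1 < d.
  by near: n; exact: near_infty_natSinv_lt (PosNum d0).
set k := n.+1%:R in k0 ki0 nd *.
have xk : x <= x + k^-1 by rewrite lerDl ltW.
rewrite (@Rintegral_support _ x (x + k^-1)); last 2 first.
- by move=> z zx; rewrite plateau'_out ?mulr0//; left.
- by move=> z zx; rewrite plateau'_out ?mulr0//; right.
have lp : locint (plateau' x k) by apply: continuous_locint; exact: continuous_plateau'.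
have mass1 : sint (plateau' x k) x (x + k^-1) = 1.
  rewrite (sint_is_derive xk (is_derive_plateau' x k) (@continuous_plateau' x k)).
  by rewrite [x + _]addrC addrK subrr mulr0 mulfV ?gt_eqF// step_ge1// step_le0// subr0.
have lfp : locint (fun z => f z * plateau' x k z).
  rewrite (_ : (fun z => _) = plateau' x k \* f); last by apply/funext => z; rewrite mulrC.
  by apply: locintM => //; exact: continuous_plateau'.
have lfb : locint (fun z => `|f z - f x|).
  by apply: locint_norm; apply: locintB => //; apply: continuous_locint => z; exact: cvg_cst.
have -> : f x - sint (fun z => f z * plateau' x k z) x (x + k^-1) =
    - sint ((fun z => f z * plateau' x k z) \- (fun z => f x * plateau' x k z)) x (x + k^-1).
  by rewrite sintB//; [rewrite sintZ// mass1; ring|exact: locintZ].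
rewrite normrN (le_trans (le_norm_sint _ _ _))//.
  by apply: locintB => //; exact: locintZ.
apply: (@le_trans _ _ (sint (fun z => k * bump_mass^-1 * `|f z - f x|) x (x + k^-1))).
  apply: le_sint.
  - by apply: locint_norm; apply: locintB => //; exact: locintZ.
  - exact: locintZ.
  - move=> z _ /=; rewrite -mulrBl normrM mulrC ler_wpM2r//.
    by rewrite ger0_norm ?plateau'_ge0 ?plateau'_le ?ltW.
rewrite sintZ//.
have := Hd _ ki0 nd.
rewrite -(@ler_pM2l _ (k * bump_mass^-1)) ?mulr_gt0 ?invr_gt0//.
move/le_trans; apply; rewrite le_eqVlt; apply/orP; left; apply/eqP.
by field; rewrite !gt_eqF.
Unshelve. all: by end_near. Qed.

(** Dominated convergence; the plateaus tend to the indicator except at [x],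
    where they all vanish. *)
Lemma plateau_cvg g x y : locint g -> x <= y ->
  (fun n => \int[mu]_z (g z * plateau x y n.+1%:R z)) @ \oo --> sint g x y.
Proof.
move=> lg xy.
have k1 n : 1 <= n.+1%:R :> R by rewrite ler1n.
have cp n : continuous (plateau x y n.+1%:R).
  apply: smooth_continuous; have [] := test_function_plateau xy (k1 n).
  by [].
have -> : (fun n => \int[mu]_z (g z * plateau x y n.+1%:R z)) =
    (fun n => sint (fun z => g z * plateau x y n.+1%:R z) x (y + 1)).
  apply/funext => n; rewrite (@Rintegral_support _ x (y + 1))//.
  - by move=> z zx; rewrite plateau_out ?mulr0//; left; exact: ltW.
  - by move=> z zx; rewrite plateau_out ?mulr0//; right; exact: ltW.
pose D := `[x, y + 1]%classic.
have mg := locint_measurable lg.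
have [] := @dominated_convergence _ _ _ mu D _
  (fun n z => (g z * plateau x y n.+1%:R z)%:E) (EFin \o (g \_ `[x, y]))
  (EFin \o (fun z => `|g z|)).
- exact: measurable_itv.
- move=> n; apply/measurable_EFinP; apply: measurable_funM.
    exact: measurable_funS mg.
  by apply: measurable_funS (continuous_measurable_fun (cp n)).
- apply/measurable_EFinP; apply: (@measurable_funS _ _ _ _ setT) => //.
  apply/(measurable_restrictT _ _).1 => //.
  exact: measurable_funS mg.
- exists [set x]; split => //; first exact: lebesgue_measure_set1.
  move=> z /= /not_implyP [Dz]; apply: contra_notP => /eqP zx.
  move: Dz; rewrite /D/= in_itv/= => /andP[xz zy1].
  have {xz} xz : x < z by rewrite lt_neqAle eq_sym zx.
  have eventually_step1 t : t < z -> \forall n \near \oo, step (n.+1%:R * (z - t)) = 1.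
    move=> tz; near=> n; apply: step_ge1.
    rewrite -ler_pdivrMr ?subr_gt0// mul1r -[leRHS]invrK lef_pV2 ?posrE ?invr_gt0 ?subr_gt0//.
    apply: ltW; near: n; apply: (near_infty_natSinv_lt (PosNum _)).
    by rewrite subr_gt0.
  have [zy|yz] := leP z y; apply: cvg_near_cst; near=> n;
    rewrite /= /patch mem_setE in_itv/= (ltW xz)/= ?zy ?leNgt ?yz/=; congr (_%:E).
  - rewrite /plateau (@step_le0 (_ * (z - y))) ?subr0.
      have -> : step (n.+1%:R * (z - x)) = 1; last by rewrite mulr1.
      by near: n; exact: eventually_step1.
    by rewrite pmulr_rle0// subr_le0.
  - rewrite /plateau.
    have -> : step (n.+1%:R * (z - x)) = 1 by near: n; exact: eventually_step1.
    have -> : step (n.+1%:R * (z - y)) = 1 by near: n; exact: eventually_step1.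
    by rewrite subrr mulr0.
- exact: locint_itv (locint_norm lg).
- apply: aeW => z n _ /=; rewrite lee_fin normrM ler_piMr//.
  rewrite /plateau; have := step_bound (n.+1%:R * (z - x)).
  have := step_bound (n.+1%:R * (z - y)); rewrite ler_norml; lra.
- move=> _ _ H.
  have E : (\int[mu]_(z in D) (EFin \o g \_ `[x, y]) z = (sint g x y)%:E)%E.
    rewrite -restrict_EFin -integral_mkcondr (_ : D `&` _ = `[x, y]); last first.
      apply/setIidr => z; rewrite /D/= !in_itv/= => /andP[-> zy].
      by rewrite (le_trans zy)// lerDl.
    rewrite /sint /Rintegral fineK//.
    exact: integrable_fin_num (locint_itv _ _ lg).
  by move: H; rewrite E => /fine_cvgP[_]; exact.
Unshelve. all: by end_near. Qed.

(** The lemma of du Bois-Reymond. Tested against [plateau x y k], the definition of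
    a weak derivative tends to the claim as k grows. Lebesgue points are enough, so
    that it also applies to functions [f] known only almost everywhere. *)
Lemma weak_derivative_primitive f g x y : locint f -> locint g ->
  is_weak_derivative f g -> lebesgue_pt f x -> lebesgue_pt f y -> x <= y ->
  f y - f x = sint g x y.
Proof.
move=> lf lg fg fx fy xy.
have F n : \int[mu]_z (f z * plateau' x n.+1%:R z) - \int[mu]_z (f z * plateau' y n.+1%:R z)
    = - \int[mu]_z (g z * plateau x y n.+1%:R z).
  have k1 : 1 <= n.+1%:R :> R by rewrite ler1n.
  rewrite -(fg _ (test_function_plateau xy k1)) derive_plateau.
  have fp t : mu.-integrable setT (EFin \o (fun z => f z * plateau' t n.+1%:R z)).
    have lfp : locint (fun z => f z * plateau' t n.+1%:R z).
      rewrite (_ : (fun z => _) = plateau' t n.+1%:R \* f); last by apply/funext => z; rewrite mulrC.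
      by apply: locintM => //; exact: continuous_plateau'.
    by apply: (@integrable_support _ t (t + n.+1%:R^-1)) => // z zx;
      rewrite plateau'_out ?mulr0//; [left|right].
  by rewrite -RintegralB//; apply: eq_Rintegral => z _; rewrite mulrBr.
have L1 := cvgB (mollification_cvg lf fx) (mollification_cvg lf fy).
have := cvgN (plateau_cvg lg xy).
rewrite [X in X @ _ --> _](_ : _ =
    (fun n => \int[mu]_z (f z * plateau' x n.+1%:R z)) -
    (fun n => \int[mu]_z (f z * plateau' y n.+1%:R z))); last first.
  by apply/funext => n; rewrite !fctE F.
move=> L2.
have : f x - f y = - sint g x y by apply: (cvg_unique (@Rhausdorff R) (L1 _) (L2 _)).
lra.
Qed.

End WeakDerivative.

(** * Absolutely continuous functions *)

Section Primitive.
Context {R : realType}.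
Local Notation mu := (@lebesgue_measure R).
Implicit Types (f g : R -> R) (a b c x y z : R).
Local Open Scope classical_set_scope.

(** [f] is absolutely continuous with derivative [g] almost everywhere. *)
Definition primitive f g := forall x y, x <= y -> f y - f x = sint g x y.

Lemma continuous_primitive f g : continuous f -> locint g ->
  is_weak_derivative f g -> primitive f g.
Proof.
move=> cf lg fg x y xy; have lf := continuous_locint cf.
have pt t : lebesgue_pt f t.
  apply: (@continuous_lebesgue_pt _ _ _ setT) => //.
  - exact: open_nbhsT.
  - exact: locint_measurable lf.
  - exact: cf.
exact: weak_derivative_primitive.
Qed.

Lemma primitive_continuous f g : locint g -> primitive f g -> continuous f.
Proof.
move=> lg fg x.
have ab : x - 1 < x + 1 by lra.
have [C _ _] := (continuous_within_itvP _ ab).1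
  (parameterized_integral_continuous (ltW ab) (locint_itv (x - 1) (x + 1) lg)).
have {}C : {for x, continuous (fun y => sint g (x - 1) y)}.
  by apply: C; rewrite in_itv/=; lra.
have E : \forall y \near x, f (x - 1) + sint g (x - 1) y = f y.
  near=> y; rewrite -(fg (x - 1) y); first by ring.
  apply: ltW; near: y; apply: lt_nbhsr; lra.
rewrite /continuous_at -(nbhs_singleton E).
apply: cvg_trans; first exact: (near_eq_cvg E).
by apply: cvgD; [exact: cvg_cst|exact: C].
Unshelve. all: by end_near. Qed.

(** Real induction: the bound between [a] and [t] passes to the supremum of the [t]
    for which it holds, and beyond it if it is not [b]. *)
Lemma increment_bound (d K : R -> R) a b e : a <= b -> 0 <= e ->
  (forall s t, a <= s -> s <= t -> t <= b -> K s <= K t) ->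
  (forall t, a <= t <= b -> exists2 r, 0 < r & forall s, a <= s <= b ->
     `|s - t| < r -> `|d s - d t| <= e * `|K s - K t|) ->
  `|d b - d a| <= e * (K b - K a).
Proof.
move=> ab e0 Kmono Hloc.
pose S := [set t | a <= t <= b /\ `|d t - d a| <= e * (K t - K a)].
have Sa : S a by rewrite /S/= lexx ab !subrr normr0 mulr0.
have Sb : ubound S b by move=> t [/andP[]].
have hS : has_sup S by split; [exists a|exists b].
set c := sup S.
have ac : a <= c by apply: ub_le_sup => //; exists b.
have cb : c <= b by apply: ge_sup => //; exists a.
have step s t : a <= s <= b -> S s -> a <= t <= b -> s <= t ->
    `|d t - d s| <= e * `|K t - K s| -> S t.
  move=> /andP[as_ sb] [_ Ss] /andP[at_ tb] st H; split; first by rewrite at_.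
  have -> : d t - d a = (d t - d s) + (d s - d a) by ring.
  apply: le_trans (ler_normD _ _) _.
  apply: le_trans (lerD H Ss) _.
  by rewrite ger0_norm ?subr_ge0 ?Kmono// -mulrDr addrA subrK.
have [|r r0 Hr] := Hloc c; first by rewrite ac.
have Sc : S c.
  have [t St] := sup_adherent r0 hS; rewrite -/c => ct.
  have tc : t <= c by apply: ub_le_sup => //; exists b.
  have tab := St.1.
  apply: (step t) => //; first by rewrite ac.
  rewrite distrC (distrC (K c)); apply: Hr => //.
  by rewrite ler0_norm ?subr_le0//; lra.
have [cb'|bc] := ltP c b; last first.
  have : S b by have -> : b = c by apply/eqP; rewrite eq_le bc.
  by case.
pose s := Num.min b (c + r / 2).
have cs : c < s by rewrite lt_min cb'/= ltrDl divr_gt0.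
have sb : s <= b by rewrite ge_min lexx.
have sr : s <= c + r / 2 by rewrite ge_min lexx orbT.
have as_ : a <= s by exact: le_trans ac (ltW cs).
have : S s.
  apply: (step c) => //; rewrite ?ac ?as_//; first exact: ltW.
  apply: Hr; first by rewrite as_.
  by rewrite gtr0_norm ?subr_gt0//; lra.
by move=> /(ub_le_sup (ex_intro _ b Sb)); rewrite leNgt cs.
Qed.

(** On a short segment [lo, hi], [f1 f2] grows by the integral of
    f1(hi) g2 + f2(lo) g1, which by continuity of [f1] and [f2] is within
    e (|g1| + |g2|) of the claimed integrand. [increment_bound] adds up these local
    errors, and e is arbitrary. *)
Lemma primitiveM f1 f2 g1 g2 : locint g1 -> locint g2 ->
  primitive f1 g1 -> primitive f2 g2 ->
  primitive (fun x => f1 x * f2 x) (fun x => f1 x * g2 x + f2 x * g1 x).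
Proof.
move=> l1 l2 p1 p2 x y xy.
have c1 := primitive_continuous l1 p1; have c2 := primitive_continuous l2 p2.
set h := (X in sint X); have lh : locint h by apply: locintD; exact: locintM.
pose k := (fun x => `|g1 x|) \+ (fun x => `|g2 x|).
have lk : locint k by apply: locintD; exact: locint_norm.
have k0 z : 0 <= k z by rewrite addr_ge0.
pose D t := f1 t * f2 t - sint h x t.
have key e : 0 < e -> `|D y - D x| <= e * (sint k x y - sint k x x).
  move=> e0; apply: (@increment_bound D (sint k x)) => //; first exact: ltW.
    move=> s t xs st ty; rewrite (sint_split lk xs st) lerDl.
    exact: sint_ge0.
  move=> t /andP[xt ty].
  have e2 : 0 < e / 2 by rewrite divr_gt0.
  have /cvgrPdist_le/(_ _ e2) N1 := c1 t; have /cvgrPdist_le/(_ _ e2) N2 := c2 t.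
  have /= := filterI N1 N2; rewrite -nbhs_ballE => -[r/= r0 Hr].
  exists r => // s /andP[xs sy] str.
  have main lo hi : x <= lo -> lo <= hi ->
      (forall z, lo <= z <= hi -> `|t - z| < r) ->
      `|D hi - D lo| <= e * `|sint k x hi - sint k x lo|.
    move=> xlo lohi near_t.
    have xhi := le_trans xlo lohi.
    rewrite /D (sint_split lh xlo lohi) (sint_split lk xlo lohi).
    rewrite [sint k x lo + _]addrC addrK (ger0_norm (sint_ge0 lo hi k0)).
    have -> : f1 hi * f2 hi - (sint h x lo + sint h lo hi) - (f1 lo * f2 lo - sint h x lo) =
        f1 hi * (f2 hi - f2 lo) + f2 lo * (f1 hi - f1 lo) - sint h lo hi by ring.
    rewrite p1// p2// -!sintZ//.
    have lz1 : locint (fun z => f1 hi * g2 z) by exact: locintZ.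
    have lz2 : locint (fun z => f2 lo * g1 z) by exact: locintZ.
    rewrite -sintD// -sintB//; last exact: locintD.
    have lA := locintB (locintD lz1 lz2) lh.
    apply: le_trans (le_norm_sint _ _ lA) _.
    apply: le_sint; [exact: locint_norm|exact: locintZ|].
    move=> z zin /=; rewrite /h /k/=.
    have -> : f1 hi * g2 z + f2 lo * g1 z - (f1 z * g2 z + f2 z * g1 z) =
      (f2 lo - f2 z) * g1 z + (f1 hi - f1 z) * g2 z by ring.
    apply: le_trans (ler_normD _ _) _; rewrite !normrM mulrDr.
    have dist w w' (f : R -> R) : `|f t - f w| <= e / 2 -> `|f t - f w'| <= e / 2 ->
        `|f w - f w'| <= e.
      move=> h1 h2; have -> : f w - f w' = (f t - f w') - (f t - f w) by ring.
      by rewrite (le_trans (ler_normB _ _))//; lra.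
    have [z1 z2] := Hr _ (near_t _ zin).
    have [|_ lo2] := Hr lo; first by apply: near_t; rewrite lexx.
    have [|hi1 _] := Hr hi; first by apply: near_t; rewrite lohi lexx.
    by apply: lerD; rewrite ler_wpM2r//; apply: dist.
  have [st|ts] := leP s t.
    rewrite distrC (distrC (sint k x s)); apply: main => // z /andP[sz zt].
    by apply: le_lt_trans str; rewrite ger0_norm ?subr_ge0// ler0_norm ?subr_le0//; lra.
  apply: main => //; first exact: ltW.
  move=> z /andP[tz zs].
  by apply: le_lt_trans str; rewrite ler0_norm ?subr_le0// gtr0_norm ?subr_gt0//; lra.
have : D y - D x = 0.
  apply/eqP; rewrite -normr_eq0 eq_le normr_ge0 andbT.
  rewrite leNgt; apply/negP => Dpos.
  have K0 : 0 <= sint k x y by exact: sint_ge0.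
  have K1 : 0 < 2 * (sint k x y + 1) by lra.
  have := key (`|D y - D x| / (2 * (sint k x y + 1))) (divr_gt0 Dpos K1).
  rewrite sint_point subr0 => H.
  have : `|D y - D x| / (2 * (sint k x y + 1)) * sint k x y < `|D y - D x|.
    rewrite -mulrA gtr_pMr// mulrC ltr_pdivrMr//; lra.
  lra.
rewrite /D sint_point; lra.
Qed.

(** The integral of (g - m)^2 is non-negative, where m is the mean of [g]. *)
Lemma Cauchy_Schwarz_sint g a b : a <= b -> locint g ->
  locint (fun x => g x ^+ 2) ->
  sint g a b ^+ 2 <= (b - a) * sint (fun x => g x ^+ 2) a b.
Proof.
move=> + lg lg2; rewrite le_eqVlt => /predU1P[<-|ab].
  by rewrite !sint_point mulr0 expr0n.
pose m := sint g a b / (b - a).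
have H : 0 <= sint (fun x => (g x - m) ^+ 2) a b.
  by apply: sint_ge0 => x; exact: sqr_ge0.
have lc : locint (fun=> m ^+ 2 : R) by apply: continuous_locint => x; exact: cvg_cst.
have E : sint (fun x => (g x - m) ^+ 2) a b =
   sint (fun x => g x ^+ 2) a b + - (2 * m) * sint g a b + m ^+ 2 * (b - a).
  rewrite -sintZ// -(sint_cst (m ^+ 2) (ltW ab)) -sintD//; last exact: locintZ.
  rewrite -sintD//; last by apply: locintD => //; exact: locintZ.
  by apply: eq_sint => x _ /=; ring.
have ba : 0 < b - a by rewrite subr_gt0.
have mE : m * (b - a) = sint g a b by rewrite /m mulfVK ?gt_eqF.
move: H; rewrite E -mE -(@ler_pM2l _ (b - a))// mulr0.
nra.
Qed.

(** At a Lebesgue point [x], g(x) is the derivative of an integral that vanishes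
    identically. *)
Lemma locint_ae_eq0 g : locint g -> (forall x y, x <= y -> sint g x y = 0) ->
  {ae mu, forall x, g x = 0}.
Proof.
move=> lg g0; have := lebesgue_differentiation lg.
apply: filterS; first exact: (ae_filter_ringOfSetsType mu).
move=> x gx; have xu : x < x + 1 by rewrite ltrDl.
have ax : (BLeft (x - 1)%R < BRight x)%E by rewrite ltEereal/=; lra.
have [_] := FTC1_lebesgue_pt xu (locint_itv (x - 1) (x + 1) lg) ax gx.
move=> <-; apply: is_derive_derive1.
have H : \forall y \near x, (cst 0 : R -> R) y = sint g (x - 1) y.
  near=> y; rewrite g0//; apply: ltW; near: y; apply: lt_nbhsr; lra.
by apply: (near_eq_is_derive H).
Unshelve. all: by end_near. Qed.

End Primitive.

(** * Translations and periodic square integrable functions *)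

Section Translation.
Context {R : realType}.
Local Notation mu := (@lebesgue_measure R).
Local Open Scope classical_set_scope.

Lemma measurable_shift (c : R) :
  measurable_fun [set: measurableTypeR R] (fun x : measurableTypeR R => x + c : measurableTypeR R).
Proof.
apply: continuous_measurable_fun => x.
by apply: cvgD => //; exact: cvg_cst.
Qed.

(** A Borel measure that agrees with Lebesgue measure on intervals is equal to it. *)
Lemma pushforward_shift (c : R) (A : set (measurableTypeR R)) : measurable A ->
  pushforward mu (fun x : measurableTypeR R => x + c : measurableTypeR R) A = mu A.
Proof.
move=> mA; pose phi : {mfun measurableTypeR R >-> measurableTypeR R} :=
  HB.pack (fun x : measurableTypeR R => x + c : measurableTypeR R)
    (isMeasurableFun.Build _ _ _ _ _ (measurable_shift c)).
symmetry; apply: (lebesgue_measure_unique (mu := pushforward mu phi)) => // X [[a b] _ <-].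
transitivity (mu `]a - c, b - c]).
  rewrite !lebesgue_measure_itv/= !lte_fin ltrD2r.
  by case: ifP => // _; rewrite -!EFinD; congr (_%:E); ring.
by congr (mu _); apply/seteqP; split=> x /=; rewrite !in_itv/= ltrBlDr lerBrDr.
Qed.

Lemma ge0_integral_shift (h : R -> \bar R) (c a b : R) :
  measurable_fun [set: R] h -> (forall x, 0%E <= h x)%E ->
  (\int[mu]_(x in `[(a + c)%R, (b + c)%R]) h x = \int[mu]_(x in `[a, b]) h (x + c)%R)%E.
Proof.
move=> mh h0.
pose phi : {mfun measurableTypeR R >-> measurableTypeR R} :=
  HB.pack (fun x : measurableTypeR R => x + c : measurableTypeR R)
    (isMeasurableFun.Build _ _ _ _ _ (measurable_shift c)).
transitivity (\int[pushforward mu phi]_(x in `[(a + c)%R, (b + c)%R]) h x)%E.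
  by apply: eq_measure_integral => A mA _; exact/esym/(pushforward_shift c mA).
rewrite ge0_integral_pushforward//; last exact: measurable_funS mh.
by congr (integral _ _ _); apply/seteqP; split=> x /=; rewrite !in_itv/= !lerD2r.
Qed.

End Translation.

Section PeriodicL2.
Context {R : realType}.
Variables xL xR : R.
Local Notation mu := (@lebesgue_measure R).
Implicit Types (f g : R -> R).
Local Open Scope classical_set_scope.

Lemma Omega_integral (h : R -> \bar R) : measurable_fun [set: R] h ->
  (forall x, 0%E <= h x)%E ->
  (\int[(Omega_measure xL xR)]_x h x = \int[mu]_(x in `[xL, xR]) h x)%E.
Proof.
move=> mh h0.
transitivity (\int[(Omega_measure xL xR)]_(x in setT `\` ~` `[xL, xR]) h x)%E.
  apply: ge0_negligible_integral => //; first exact: measurableC.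
  by rewrite /Omega_measure/= /mrestr setICl measure0.
rewrite setTD setCK; apply: eq_measure_integral => A mA AD.
by rewrite /Omega_measure/= /mrestr; congr (mu _); exact/setIidl.
Qed.

Lemma expe2_poweR (x : \bar R) : (0 <= x -> x ^+ 2 = x `^ 2)%E.
Proof.
move: x => [x|_|//]; last by rewrite poweRyr// expe2 mulyy.
by rewrite lee_fin poweR_EFin => x0; rewrite powR_mulrn// expe2 -EFinM expr2.
Qed.

Lemma L2norm_sqr f : measurable_fun [set: R] f ->
  (L2norm xL xR f ^+ 2 = \int[mu]_(x in `[xL, xR]) (f x ^+ 2)%:E)%E.
Proof.
move=> mf; rewrite -Omega_integral; last 2 first.
- by apply/measurable_EFinP; apply: measurable_funX.
- by move=> x; rewrite lee_fin sqr_ge0.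
rewrite /L2norm expe2_poweR ?Lnorm_ge0// powR_Lnorm//.
by apply: eq_integral => x _ /=; rewrite powR_mulrn// real_normK// num_real.
Qed.

Lemma L2p_sqr_lty f : L2p xL xR f ->
  (\int[mu]_(x in `[xL, xR]) (f x ^+ 2)%:E < +oo)%E.
Proof.
case=> mf _ foo; rewrite -L2norm_sqr// expe2_poweR ?Lnorm_ge0//.
exact: poweR_lty.
Qed.

Lemma ge0_integral_glue_lty (h : R -> \bar R) (a b c : R) :
  measurable_fun [set: R] h -> (forall x, 0%E <= h x)%E -> a <= b -> b <= c ->
  (\int[mu]_(x in `[a, b]) h x < +oo)%E -> (\int[mu]_(x in `[b, c]) h x < +oo)%E ->
  (\int[mu]_(x in `[a, c]) h x < +oo)%E.
Proof.
move=> mh h0 ab bc hab hbc.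
have -> : `[a, c]%classic = `[a, b] `|` `]b, c].
  by rewrite -itv_bndbnd_setU// bnd_simp.
rewrite ge0_integral_setU//.
- rewrite lte_add_pinfty//; apply: le_lt_trans hbc.
  apply: ge0_subset_integral => //; first exact: measurable_funS mh.
  by apply: subset_itvr; rewrite bnd_simp.
- exact: measurable_funS mh.
- apply/disj_setPS => y [/=]; rewrite !in_itv/= => /andP[_ yb] /andP[].
  by rewrite ltNge yb.
Qed.


(** Finitely many translates of the period cover any given segment. *)
Lemma L2p_locint2 f : xL < xR -> L2p xL xR f -> locint (fun x => f x ^+ 2).
Proof.
move=> xLR fL2; have foo := L2p_sqr_lty fL2; case: fL2 => mf pf _.
have mf2 : measurable_fun [set: R] (fun x => (f x ^+ 2)%:E).
  by apply/measurable_EFinP; apply: measurable_funX.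
have f20 x : (0%E <= (f x ^+ 2)%:E)%E by rewrite lee_fin sqr_ge0.
pose L : R := xR - xL; have L0 : 0 < L by rewrite subr_gt0.
have pfn n x : f (x + n%:R * L) = f x.
  elim: n => [|n IH]; first by rewrite mul0r addr0.
  by rewrite mulrSr mulrDl mul1r addrA pf.
have per c : (forall x, f (x + c) = f x) ->
    (\int[mu]_(x in `[(xL + c)%R, (xR + c)%R]) (f x ^+ 2)%:E < +oo)%E.
  move=> fc; rewrite (ge0_integral_shift _ _ _ mf2 f20).
  by under eq_integral do rewrite fc.
have grow n : (\int[mu]_(x in `[(xL - n%:R * L)%R, (xR + n%:R * L)%R]) (f x ^+ 2)%:E < +oo)%E.
  elim: n => [|n IH]; first by rewrite mul0r subr0 addr0.
  have Ln : 0 <= n%:R * L by rewrite mulr_ge0// ltW.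
  apply: (@ge0_integral_glue_lty _ _ (xR + n%:R * L)) => //.
  - by rewrite mulrSr; lra.
  - by rewrite mulrSr; lra.
  - apply: (@ge0_integral_glue_lty _ _ (xL - n%:R * L)) => //.
    + by rewrite mulrSr; lra.
    + by lra.
    + have := per (- (n.+1%:R * L)) _; rewrite (_ : xR - n.+1%:R * L = xL - n%:R * L).
        by apply => x; rewrite -(pfn n.+1) subrK.
      by rewrite mulrSr; rewrite /L; ring.
  - have := per (n.+1%:R * L) (pfn n.+1); rewrite (_ : xL + n.+1%:R * L = xR + n%:R * L)//.
    by rewrite mulrSr; rewrite /L; ring.
apply: itv_locint; first by apply: measurable_funX.
move=> a b; apply/integrableP; split; first exact: measurable_funS mf2.
pose n := (Num.bound ((`|a| + `|b| + `|xL| + `|xR|) / L)).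
have nL : `|a| + `|b| + `|xL| + `|xR| <= n%:R * L.
  rewrite -ler_pdivrMr//; apply/ltW/archi_boundP.
  by apply: divr_ge0; [rewrite !addr_ge0|exact: ltW].
apply: le_lt_trans (grow n).
rewrite [X in integral _ _ X](_ : _ = fun x => (f x ^+ 2)%:E); last first.
  by apply/funext => x; rewrite /= ger0_norm ?sqr_ge0.
apply: ge0_subset_integral => //; first exact: measurable_funS mf2.
have ha := ler_norm (- a); have hb := ler_norm b; have ha0 := normr_ge0 a.
have hb0 := normr_ge0 b; have hL := ler_norm xL; have hR := ler_norm (- xR).
rewrite !normrN in ha hR; have hL0 := normr_ge0 xL; have hR0 := normr_ge0 xR.
by apply: subset_itv; rewrite bnd_simp; lra.
Qed.

Lemma L2p_locint f : xL < xR -> L2p xL xR f -> locint f.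
Proof.
move=> xLR fL2; have lf2 := L2p_locint2 xLR fL2; case: fL2 => mf _ _.
apply: itv_locint => // a b.
have lb : locint (fun x => 1 + f x ^+ 2).
  by apply: (@locintD _ (cst 1)) => //; apply: continuous_locint => x; exact: cvg_cst.
apply: (le_integrable _ _ _ (locint_itv a b lb)) => //.
  by apply/measurable_EFinP; exact: measurable_funS mf.
move=> x _ /=; rewrite lee_fin [leRHS]ger0_norm ?addr_ge0 ?sqr_ge0//.
rewrite -real_normK ?num_real//; have := normr_ge0 (f x); nra.
Qed.

Lemma L2pM_locint f g : xL < xR -> L2p xL xR f -> L2p xL xR g -> locint (fun x => f x * g x).
Proof.
move=> xLR fL2 gL2; have lf2 := L2p_locint2 xLR fL2; have lg2 := L2p_locint2 xLR gL2.
case: fL2 => mf _ _; case: gL2 => mg _ _.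
have mfg : measurable_fun [set: R] (fun x => f x * g x) by exact: measurable_funM.
apply: itv_locint => // a b.
apply: (le_integrable _ _ _ (locint_itv a b (locintD lf2 lg2))) => //.
  by apply/measurable_EFinP; exact: measurable_funS mfg.
move=> x _ /=; rewrite lee_fin [leRHS]ger0_norm ?addr_ge0 ?sqr_ge0// normrM.
rewrite -(real_normK (num_real (f x))) -(real_normK (num_real (g x))).
have := normr_ge0 (f x); have := normr_ge0 (g x); nra.
Qed.

Lemma L2norm_sqr_sint f : xL < xR -> L2p xL xR f ->
  (L2norm xL xR f ^+ 2 = (sint (fun x => f x ^+ 2) xL xR)%:E)%E.
Proof.
move=> xLR fL2; rewrite L2norm_sqr; last by case: fL2.
rewrite /sint /Rintegral fineK//.
exact: integrable_fin_num (locint_itv _ _ (L2p_locint2 xLR fL2)).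
Qed.

End PeriodicL2.

(** * Periodic functions with a weak derivative *)

Section TestFunctions.
Context {R : realType}.
Local Notation mu := (@lebesgue_measure R).
Implicit Types (f g phi : R -> R).
Local Open Scope classical_set_scope.

Lemma test_function_derive phi : test_function phi -> test_function phi^`()%classic.
Proof.
case=> sphi cphi; split; first exact: smooth_derive.
apply: (subclosed_compact _ cphi); first exact: closed_closure.
rewrite [X in _ `<=` X](closure_id _).1; last exact: closed_closure.
apply: closureS => x; apply: contra_neqP => nx; apply: is_derive_derive1.
have : nbhs x (~` closure [set x | phi x != 0]).
  by apply: open_nbhs_nbhs; split => //; apply: closed_openC; exact: closed_closure.
move=> H; have {}H : \forall y \near x, (cst 0 : R -> R) y = phi y.
  apply: filterS H => y; apply: contra_notP => /eqP; rewrite eq_sym => h.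
  exact: subset_closure.
by apply: (near_eq_is_derive H).
Qed.

Lemma test_function_support phi : test_function phi ->
  exists a b, (forall x, x < a -> phi x = 0) /\ (forall x, b < x -> phi x = 0).
Proof.
case=> _ /compact_bounded[M [Mr MK]].
have {}MK x : phi x != 0 -> `|x| <= M + 1.
  by move=> ?; apply: (MK (M + 1)); [rewrite ltrDl|exact: subset_closure].
exists (- (M + 1)), (M + 1); split => x xM; apply/eqP; apply: contraTT xM => /MK;
  by rewrite ler_norml -leNgt => /andP[].
Qed.

Lemma test_function_continuous phi : test_function phi -> continuous phi.
Proof. by case=> ? _; exact: smooth_continuous. Qed.

Lemma integrable_test f phi : locint f -> test_function phi ->
  mu.-integrable [set: R] (EFin \o (fun x => f x * phi x)).
Proof.
move=> lf tphi; have [a [b [pa pb]]] := test_function_support tphi.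
have lfp : locint (fun x => f x * phi x).
  rewrite (_ : (fun z => _) = phi \* f); last by apply/funext => z; rewrite mulrC.
  by apply: locintM => //; exact: test_function_continuous.
by apply: (integrable_support (a := a) (b := b)) => // x;
  [move=> /pa|move=> /pb] => ->; rewrite mulr0.
Qed.

Lemma Rintegral_testD f g k1 k2 phi : locint f -> locint g -> test_function phi ->
  \int[mu]_x ((k1 * f x + k2 * g x) * phi x) =
  k1 * \int[mu]_x (f x * phi x) + k2 * \int[mu]_x (g x * phi x).
Proof.
move=> lf lg tp.
have If := integrable_test lf tp; have Ig := integrable_test lg tp.
have Ikf := integrable_test (locintZ k1 lf) tp.
have Ikg := integrable_test (locintZ k2 lg) tp.
rewrite -!RintegralZl//.
have kf : mu.-integrable setT (EFin \o (fun x => k1 * (f x * phi x))).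
  by apply: eq_integrable Ikf => // x _ /=; rewrite mulrA.
have kg : mu.-integrable setT (EFin \o (fun x => k2 * (g x * phi x))).
  by apply: eq_integrable Ikg => // x _ /=; rewrite mulrA.
by rewrite -RintegralD//; apply: eq_Rintegral => x _; ring.
Qed.

Lemma is_weak_derivative_linear f g f' g' k1 k2 :
  locint f -> locint g -> locint f' -> locint g' ->
  is_weak_derivative f f' -> is_weak_derivative g g' ->
  is_weak_derivative (fun x => k1 * f x + k2 * g x) (fun x => k1 * f' x + k2 * g' x).
Proof.
move=> lf lg lf' lg' Hf Hg phi tp.
rewrite !Rintegral_testD//; last exact: test_function_derive.
by rewrite Hf// Hg//; ring.
Qed.

End TestFunctions.

Section PeriodicH1.
Context {R : realType}.
Variables xL xR : R.
Local Notation mu := (@lebesgue_measure R).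
Local Notation H1p := (H1p xL xR).
Local Notation L2p := (L2p xL xR).
Local Notation D := (weak_derivative xL xR).
Implicit Types (f g : R -> R).
Local Open Scope classical_set_scope.

Lemma L2p_intro f : measurable_fun [set: R] f -> periodic f (xR - xL) ->
  locint (fun x => f x ^+ 2) -> L2p f.
Proof.
move=> mf pf lf; split => //.
rewrite /L2norm unlock; apply: poweR_lty.
have /integrable_lty := locint_itv xL xR lf.
move=> /(_ (measurable_itv _)); rewrite -Omega_integral.
- congr (_ < _)%E; apply: eq_integral => x _ /=.
  by rewrite powR_mulrn// real_normK// num_real.
- by apply/measurable_EFinP; apply: measurable_funX.
- by move=> x; rewrite lee_fin sqr_ge0.
Qed.

Lemma L2p_linear f g k1 k2 : xL < xR -> L2p f -> L2p g ->
  L2p (fun x => k1 * f x + k2 * g x).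
Proof.
move=> xLR fL gL.
have lf := L2p_locint2 xLR fL; have lg := L2p_locint2 xLR gL.
have lfg := L2pM_locint xLR fL gL.
case: (fL) => mf pf _; case: (gL) => mg pg _.
apply: L2p_intro.
- by apply: measurable_funD; apply: measurable_funM.
- by move=> x; rewrite pf pg.
- rewrite (_ : (fun x => _) = (fun x => k1 ^+ 2 * f x ^+ 2) \+
     ((fun x => 2 * k1 * k2 * (f x * g x)) \+ (fun x => k2 ^+ 2 * g x ^+ 2))).
    by apply: locintD; [exact: locintZ|apply: locintD; exact: locintZ].
  by apply/funext => x /=; ring.
Qed.

Lemma weak_derivativeP f : H1p f -> L2p (D f) /\ is_weak_derivative f (D f).
Proof.
case=> _ _ [g gL fg]; apply: (@xgetPex _ (fun=> 0)
  [set g | L2p g /\ is_weak_derivative f g]).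
by exists g.
Qed.

Lemma H1p_primitive f : xL < xR -> H1p f -> primitive f (D f).
Proof.
move=> xLR fH; have [gL fg] := weak_derivativeP fH; case: fH => cf _ _.
by apply: continuous_primitive => //; exact: L2p_locint gL.
Qed.

Lemma H1p_linear f g k1 k2 : xL < xR -> H1p f -> H1p g ->
  H1p (fun x => k1 * f x + k2 * g x) /\
  is_weak_derivative (fun x => k1 * f x + k2 * g x)
    (fun x => k1 * D f x + k2 * D g x).
Proof.
move=> xLR fH gH.
have [Df fD] := weak_derivativeP fH; have [Dg gD] := weak_derivativeP gH.
case: (fH) => cf Lf _; case: (gH) => cg Lg _.
have W : is_weak_derivative (fun x => k1 * f x + k2 * g x)
    (fun x => k1 * D f x + k2 * D g x).
  by apply: is_weak_derivative_linear => //; exact: (@L2p_locint _ xL xR).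
split => //; split.
- by move=> x; apply: cvgD; apply: cvgM => //; try exact: cvg_cst; [exact: cf|exact: cg].
- exact: L2p_linear.
- by exists (fun x => k1 * D f x + k2 * D g x) => //; exact: L2p_linear.
Qed.

(** By the du Bois-Reymond lemma two weak derivatives of a continuous function have
    the same integral over every segment, so they agree almost everywhere. *)
Lemma weak_derivative_unique f g : xL < xR -> H1p f -> L2p g ->
  is_weak_derivative f g ->
  sint (fun x => D f x ^+ 2) xL xR = sint (fun x => g x ^+ 2) xL xR.
Proof.
move=> xLR fH gL fg; have [DL fD] := weak_derivativeP fH.
case: (fH) => cf _ _.
have lg := L2p_locint xLR gL; have lD := L2p_locint xLR DL.
have p1 := continuous_primitive cf lD fD; have p2 := continuous_primitive cf lg fg.
have ae0 : {ae mu, forall x, (D f \- g) x = 0}.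
  apply: locint_ae_eq0; first exact: locintB.
  by move=> x y xy; rewrite sintB// -p1// -p2// subrr.
rewrite /sint /Rintegral; congr fine.
have [m1 _ _] := DL; have [m2 _ _] := gL.
apply: ae_eq_integral => //.
- by apply/measurable_EFinP; apply: measurable_funX; exact: measurable_funS m1.
- by apply/measurable_EFinP; apply: measurable_funX; exact: measurable_funS m2.
- apply: filterS ae0; first exact: (ae_filter_ringOfSetsType mu).
  by move=> x /= /eqP; rewrite subr_eq0 => /eqP ->.
Qed.

Lemma H1norm_sqr f g : xL < xR -> H1p f -> L2p g -> is_weak_derivative f g ->
  H1norm xL xR f =
  (Num.sqrt (sint (fun x => f x ^+ 2) xL xR + sint (fun x => g x ^+ 2) xL xR))%:E.
Proof.
move=> xLR fH gL fg; have [DL _] := weak_derivativeP fH; case: (fH) => _ fL _.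
rewrite /H1norm !L2norm_sqr_sint// (weak_derivative_unique xLR fH gL fg).
rewrite -EFinD poweR_EFin powR12_sqrt// addr_ge0//; apply: sint_ge0 => x; exact: sqr_ge0.
Qed.

Lemma sqr_increment_le f x y : xL < xR -> H1p f ->
  xL <= x <= xR -> xL <= y <= xR -> x <= y ->
  (f y - f x) ^+ 2 <= (y - x) * sint (fun z => D f z ^+ 2) x y.
Proof.
move=> xLR fH _ _ xy; rewrite (H1p_primitive xLR fH xy).
have [DL _] := weak_derivativeP fH.
by apply: Cauchy_Schwarz_sint => //; [exact: L2p_locint DL|exact: L2p_locint2 DL].
Qed.

Lemma sint_sub_le g a b c d : locint g -> (forall x, 0 <= g x) ->
  a <= b -> b <= c -> c <= d -> sint g b c <= sint g a d.
Proof.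
move=> lg g0 ab bc cd.
rewrite (sint_split lg ab (le_trans bc cd)) (sint_split lg bc cd).
by have := sint_ge0 a b g0; have := sint_ge0 c d g0; lra.
Qed.

(** Sobolev embedding: (f(x) - f(y))^2 is at most L times the squared norm of the
    derivative for every [y] in the period; average f(x)^2 <= 2 f(y)^2 +
    2 (f(x) - f(y))^2 over [y]. *)
Lemma H1p_sup f x : xL < xR -> H1p f -> xL <= x <= xR ->
  f x ^+ 2 <= 2 / (xR - xL) * sint (fun z => f z ^+ 2) xL xR +
              2 * (xR - xL) * sint (fun z => D f z ^+ 2) xL xR.
Proof.
move=> xLR fH xin; have [DL _] := weak_derivativeP fH; have [_ fL _] := fH.
have lD2 := L2p_locint2 xLR DL; have lf2 := L2p_locint2 xLR fL.
pose L : R := xR - xL; have L0 : 0 < L by rewrite subr_gt0.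
pose J : R := sint (fun z => D f z ^+ 2) xL xR.
have D20 z : 0 <= D f z ^+ 2 by exact: sqr_ge0.
have key y z : xL <= y -> y <= z -> z <= xR -> (f z - f y) ^+ 2 <= L * J.
  move=> xLy yz zxR; apply: le_trans (sqr_increment_le xLR fH _ _ yz) _.
  - by rewrite xLy (le_trans yz).
  - by rewrite zxR (le_trans xLy).
  - by apply: ler_pM; rewrite ?subr_ge0// ?sint_ge0 ?sint_sub_le// /L lerB.
have H y : xL <= y <= xR -> f x ^+ 2 <= 2 * f y ^+ 2 + 2 * (L * J).
  move=> /andP[y1 y2]; case/andP: xin => x1 x2.
  have : (f x - f y) ^+ 2 <= L * J.
    have [xy|yx] := leP x y; last exact: key (ltW yx) _.
    by rewrite -sqrrN opprB; exact: key.
  have := sqr_ge0 (f x - f y - f y); rewrite !expr2; lra.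
have lc c : locint (fun=> c : R) by apply: continuous_locint => z; exact: cvg_cst.
have : sint (fun=> f x ^+ 2) xL xR <= sint ((fun y => 2 * f y ^+ 2) \+ (fun=> 2 * (L * J))) xL xR.
  by apply: le_sint => //; apply: locintD => //; exact: locintZ.
rewrite sintD//; last exact: locintZ.
rewrite sintZ// !sint_cst ?(ltW xLR)// -/L.
rewrite -ler_pdivlMr// => /le_trans; apply.
by rewrite -/J le_eqVlt; apply/orP; left; apply/eqP; field; rewrite gt_eqF.
Qed.

Lemma Linfnorm_le f C : 0 <= C -> (forall x, xL <= x <= xR -> `|f x| <= C) ->
  (Linfnorm xL xR f <= C%:E)%E.
Proof.
move=> C0 fC; rewrite /Linfnorm unlock; case: ifPn => // _.
apply/ess_supP; exists (~` `[xL, xR]%classic); split.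
- exact: measurableC.
- by rewrite /Omega_measure/= /mrestr setICl measure0.
- move=> x /=; apply: contra_not; rewrite in_itv/= lee_fin; exact: fC.
Qed.

Lemma L2norm_le f C : xL < xR -> L2p f -> 0 <= C ->
  sint (fun x => f x ^+ 2) xL xR <= C ^+ 2 -> (L2norm xL xR f <= C%:E)%E.
Proof.
move=> xLR fL C0; rewrite -lee_fin -(L2norm_sqr_sint xLR fL).
have [_ _] := fL; have := @Lnorm_ge0 _ _ _ (Omega_measure xL xR) 2%:E (EFin \o f).
rewrite -/(L2norm xL xR f); case: (L2norm xL xR f) => // r.
rewrite expe2 -EFinM !lee_fin -expr2 => r0 _.
by rewrite ler_pXn2r// nnegrE.
Qed.

End PeriodicH1.

(** * The equation tested with its solution *)

Section Periodicity.
Context {R : realType}.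
Local Notation mu := (@lebesgue_measure R).
Implicit Types (f g h : R -> R).
Local Open Scope classical_set_scope.

Lemma sint_shift h c a b : measurable_fun [set: R] h ->
  (forall x, h (x + c) = h x) -> sint h (a + c) (b + c) = sint h a b.
Proof.
move=> mh hc; rewrite /sint /Rintegral; congr fine.
have mEh : measurable_fun [set: R] (EFin \o h) by exact/measurable_EFinP.
rewrite integralE [RHS]integralE; congr (_ - _)%E.
  rewrite (ge0_integral_shift c a b (measurable_funepos mEh)); last first.
    by move=> x; exact: funepos_ge0.
  by apply: eq_integral => x _; rewrite !funeposE/= hc.
rewrite (ge0_integral_shift c a b (measurable_funeneg mEh)); last first.
  by move=> x; exact: funeneg_ge0.
by apply: eq_integral => x _; rewrite !funenegE/= hc.
Qed.

(** A null set and its translate cannot cover a segment of positive length. *)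
Lemma ae_periodic_point (P : R -> Prop) (a b c : R) : a < b ->
  {ae mu, forall x, P x} -> exists x, [/\ a <= x <= b, P x & P (x + c)].
Proof.
move=> ab [N [mN N0 PN]]; apply: contrapT => H.
have sub : `[a, b]%classic `<=` N `|` (fun x : R => x + c) @^-1` N.
  move=> x; rewrite /= in_itv/= => xab; apply: contrapT => /not_orP[nx nxc].
  by apply: H; exists x; split => //; apply: contrapT => np; [apply: nx|apply: nxc]; exact: PN.
have Nc0 : mu ((fun x : R => x + c) @^-1` N) = 0%E.
  by rewrite -N0 -(pushforward_shift c mN).
have mNc : measurable ((fun x : R => x + c) @^-1` N).
  by rewrite -[X in measurable X]setTI; exact: measurable_shift.
have : (mu `[a, b] <= mu N + mu ((fun x : R => x + c)%R @^-1` N))%E.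
  apply: (@le_trans _ _ (mu (N `|` (fun x : R => x + c) @^-1` N))).
    by apply: le_measure => //; rewrite inE//; exact: measurableU.
  exact: measureU2.
rewrite N0 Nc0 adde0 lebesgue_measure_itv/= lte_fin ab -EFinD lee_fin.
by rewrite leNgt subr_gt0 ab.
Qed.

End Periodicity.

Section EnergyIdentity.
Context {R : realType}.
Variables xL xR : R.
Local Notation mu := (@lebesgue_measure R).
Local Notation H1p := (H1p xL xR).
Local Notation L2p := (L2p xL xR).
Local Notation D := (weak_derivative xL xR).
Implicit Types (u v : R -> R).
Local Open Scope classical_set_scope.

Lemma periodic_end (f : R -> R) : periodic f (xR - xL) -> f xR = f xL.
Proof. by move=> /(_ xL); rewrite addrCA subrr addr0. Qed.

Lemma continuous_sqr (f : R -> R) : continuous f -> continuous (fun x => f x ^+ 2).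
Proof.
move=> cf; rewrite (_ : (fun x => _) = (fun x => f x * f x)).
  by move=> x; apply: cvgM; exact: cf.
by apply/funext => x; rewrite expr2.
Qed.

(** [G] agrees almost everywhere with an antiderivative [Gc] of [v], so that the
    claim is the product rule for [Gc u] over one period. The boundary terms cancel
    because [v] has mean 0: take a Lebesgue point [x0] of [G] such that x0 + L is one
    too, where [G] takes the same value. *)
Lemma weak_parts (G v u : R -> R) : xL < xR -> L2p G -> continuous v ->
  is_weak_derivative G v -> periodic v (xR - xL) -> H1p u ->
  sint (fun x => G x * D u x) xL xR + sint (fun x => u x * v x) xL xR = 0.
Proof.
move=> xLR GL cv Gv pv uH; have [DL uD] := weak_derivativeP uH.
have lG := L2p_locint xLR GL; have lv := continuous_locint cv.
have lD := L2p_locint xLR DL.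
have [mG pG _] := GL; have [cu [_ pu _] _] := uH.
have aeG := lebesgue_differentiation lG.
have [x0 [/andP[xLx0 x0xR] Px0 Px0L]] := ae_periodic_point (xR - xL) xLR aeG.
have Gt x y : lebesgue_pt G x -> lebesgue_pt G y -> x <= y -> G y - G x = sint v x y.
  exact: weak_derivative_primitive.
have v0 : sint v xL xR = 0.
  have : sint v x0 (x0 + (xR - xL)) = 0.
    by rewrite -Gt//; [rewrite pG subrr|rewrite lerDl subr_ge0 ltW].
  have xR1 : xR <= x0 + (xR - xL) by lra.
  rewrite (sint_split lv x0xR xR1) (sint_split lv xLx0 x0xR).
  have -> : sint v xR (x0 + (xR - xL)) = sint v xL x0.
    rewrite -(sint_shift xL x0 (continuous_measurable_fun cv) pv).
    by rewrite [xL + _]addrC subrK.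
  lra.
pose Gc x := if x0 <= x then G x0 + sint v x0 x else G x0 - sint v x x0.
have pGc : primitive Gc v.
  move=> x y xy; rewrite /Gc.
  have [x0y|yx0] := leP x0 y; have [x0x|xx0] := leP x0 x.
  - by rewrite (sint_split lv x0x xy); ring.
  - by rewrite (sint_split lv (ltW xx0) x0y); ring.
  - by have := le_lt_trans (le_trans x0x xy) yx0; rewrite ltxx.
  - by rewrite (sint_split lv xy (ltW yx0)); ring.
have cGc := primitive_continuous lv pGc.
have aeGc : {ae mu, forall x, Gc x = G x}.
  apply: filterS aeG; first exact: (ae_filter_ringOfSetsType mu).
  move=> x Gx; rewrite /Gc; have [x0x|xx0] := leP x0 x.
    by rewrite -Gt// addrC subrK.
  by rewrite -(Gt x x0 Gx Px0 (ltW xx0)); ring.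
have -> : sint (fun x => G x * D u x) xL xR = sint (fun x => Gc x * D u x) xL xR.
  rewrite /sint /Rintegral; congr fine.
  have mD := locint_measurable lD; have mGc := continuous_measurable_fun cGc.
  apply: ae_eq_integral => //.
  - by apply/measurable_EFinP; apply: measurable_funM; [exact: measurable_funS mG|exact: measurable_funS mD].
  - by apply/measurable_EFinP; apply: measurable_funM; [exact: measurable_funS mGc|exact: measurable_funS mD].
  - apply: filterS aeGc; first exact: (ae_filter_ringOfSetsType mu).
    by move=> x /= ->.
have pu' := H1p_primitive xLR uH.
rewrite -(@sintD _ (fun x => Gc x * D u x) (fun x => u x * v x)); [|exact: locintM..].
rewrite -(primitiveM lv lD pGc pu' (ltW xLR)).
have := pGc _ _ (ltW xLR); rewrite v0 (periodic_end pu) => /eqP; rewrite subr_eq0 => /eqP ->.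
by rewrite subrr.
Qed.

(** The solution [u] is not a test function, so the equation cannot be tested with
    it directly. But the equation says that G = sigma v' - a u - gamma/2 u^2 has weak
    derivative [v], and [weak_parts] allows [u] as a factor; u u' and u^2 u' are exact
    derivatives of periodic functions and integrate to 0. *)
Lemma energy_identity (a sigma gamma : R) u v : xL < xR -> H1p u -> H1p v ->
  (forall phi, test_function phi ->
     \int[mu]_x (v x * phi x - a * u x * phi^`()%classic x
            - sigma * v x * phi^`(2)%classic x
            - gamma / 2 * u x ^+ 2 * phi^`()%classic x) = 0) ->
  sint (fun x => v x * u x) xL xR + sigma * sint (fun x => D v x * D u x) xL xR = 0.
Proof.
move=> xLR uH vH eqn.
have [DuL uD] := weak_derivativeP uH; have [DvL vD] := weak_derivativeP vH.
have [cu uL _] := uH; have [cv vL _] := vH.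
have [_ pu _] := uL; have [_ pv _] := vL; have [mDv pDv _] := DvL.
have lu := continuous_locint cu; have lv := continuous_locint cv.
have lDv := L2p_locint xLR DvL; have lDu := L2p_locint xLR DuL.
have rearrange (x y z : R) : x - y - sigma * - z = 0 -> sigma * z + -1 * y = - x.
  by clear; lra.
pose q x := a * u x + gamma / 2 * u x ^+ 2.
have cq : continuous q.
  move=> x; apply: cvgD; apply: cvgM; try exact: cvg_cst; first exact: cu.
  exact: continuous_sqr.
have lq := continuous_locint cq.
pose G x := sigma * D v x + -1 * q x.
have Gv : is_weak_derivative G v.
  move=> phi tp; have tp1 := test_function_derive tp.
  have tp2 := test_function_derive tp1.
  rewrite /G Rintegral_testD//.
  have := vD _ tp1; have := eqn _ tp.
  have Iv := integrable_test lv tp.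
  have Iq := integrable_test lq tp1.
  have Iv2 := integrable_test lv tp2.
  have Isv2 := integrable_test (locintZ sigma lv) tp2.
  have Ivq := integrableB measurableT Iv Iq.
  have scal : \int[mu]_x (sigma * v x * phi^`()^`()%classic x) =
      sigma * \int[mu]_x (v x * phi^`()^`()%classic x).
    by rewrite -RintegralZl//; apply: eq_Rintegral => x _; rewrite mulrA.
  have -> : \int[mu]_x (v x * phi x - a * u x * phi^`()%classic x
      - sigma * v x * phi^`(2)%classic x - gamma / 2 * u x ^+ 2 * phi^`()%classic x) =
      \int[mu]_x (v x * phi x) - \int[mu]_x (q x * phi^`()%classic x)
      - sigma * \int[mu]_x (v x * phi^`()^`()%classic x).
    rewrite -scal -(RintegralB measurableT Iv Iq) -(RintegralB measurableT Ivq Isv2).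
    by apply: eq_Rintegral => x _; rewrite /q /derive1n/=; ring.
  move=> + e2; rewrite e2; exact: rearrange.
have qL : L2p q.
  apply: L2p_intro.
  - exact: continuous_measurable_fun.
  - by move=> x; rewrite /q pu.
  - by apply: continuous_locint; exact: continuous_sqr.
have GL : L2p G by exact: L2p_linear.
have parts := weak_parts xLR GL cv Gv pv uH.
have pu' := H1p_primitive xLR uH.
have uR := periodic_end pu.
have lup : locint (fun x => u x * D u x) by exact: locintM.
have pu2 := primitiveM lDu lDu pu' pu'.
have lu2' : locint (fun x => u x * D u x + u x * D u x) by exact: locintD.
have cu2 : continuous (fun x => u x * u x) by move=> x; apply: cvgM; exact: cu.
have luup : locint (fun x => u x ^+ 2 * D u x).
  rewrite (_ : (fun x => _) = (fun x => u x * u x) \* D u); last first.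
    by apply/funext => x; rewrite /= expr2.
  exact: locintM.
have up0 : sint (fun x => u x * D u x) xL xR = 0.
  have := pu2 _ _ (ltW xLR); rewrite (@sintD _ (fun x => u x * D u x) (fun x => u x * D u x))//.
  rewrite uR; lra.
have uup0 : sint (fun x => u x ^+ 2 * D u x) xL xR = 0.
  have := primitiveM lu2' lDu pu2 pu' (ltW xLR).
  rewrite uR subrr (eq_sint (g := fun x => 3 * (u x ^+ 2 * D u x))); last first.
    by move=> x _; ring.
  rewrite sintZ//; lra.
have lGp : locint (fun x => G x * D u x) by exact: (@L2pM_locint _ xL xR).
have E : sigma * sint (fun x => D v x * D u x) xL xR =
    sint (fun x => G x * D u x) xL xR + (a * sint (fun x => u x * D u x) xL xR
      + gamma / 2 * sint (fun x => u x ^+ 2 * D u x) xL xR).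
  have lvp : locint (fun x => D v x * D u x) by exact: (@L2pM_locint _ xL xR).
  have l1 := locintZ a lup; have l2 := locintZ (gamma / 2) luup.
  rewrite -!sintZ// -sintD// -sintD//; last exact: locintD.
  by apply: eq_sint => x _; rewrite /= /G /q; ring.
rewrite E up0 uup0 !mulr0 addr0 addrC.
rewrite (eq_sint (f := fun x => v x * u x) (g := fun x => u x * v x)); last first.
  by move=> x _; rewrite mulrC.
by rewrite addr0.
Qed.

End EnergyIdentity.

(** * Conservation of energy *)

Section EnergyConservation.
Context {R : realType}.
Variables xL xR : R.
Local Notation mu := (@lebesgue_measure R).
Local Notation H1p := (H1p xL xR).
Local Notation L2p := (L2p xL xR).
Local Notation D := (weak_derivative xL xR).
Implicit Types (f g q v w : R -> R).
Local Open Scope classical_set_scope.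

(** Here [v] moves by d (q + w) in time [d], where [w] is its velocity and [q] the
    error of the difference quotient. Expand the square, and split the product
    v q by Young's inequality 2 |v q| <= eta v^2 + q^2 / eta. *)
Lemma quadratic_increment v q w (d eta : R) : xL < xR ->
  L2p v -> L2p q -> L2p w -> 0 < eta ->
  `|sint (fun x => (v x + d * (q x + w x)) ^+ 2) xL xR - sint (fun x => v x ^+ 2) xL xR
    - 2 * d * sint (fun x => w x * v x) xL xR| <=
  `|d| * (eta * sint (fun x => v x ^+ 2) xL xR + eta^-1 * sint (fun x => q x ^+ 2) xL xR
     + `|d| * (2 * sint (fun x => q x ^+ 2) xL xR + 2 * sint (fun x => w x ^+ 2) xL xR)).
Proof.
move=> xLR vL qL wL eta0.
have lv2 := L2p_locint2 xLR vL; have lq2 := L2p_locint2 xLR qL; have lw2 := L2p_locint2 xLR wL.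
have lvq := L2pM_locint xLR vL qL; have lwv := L2pM_locint xLR wL vL.
have qwL : L2p (fun x => 1 * q x + 1 * w x) by exact: L2p_linear.
have lqw2 := L2p_locint2 xLR qwL.
have E : sint (fun x => (v x + d * (q x + w x)) ^+ 2) xL xR =
    sint (fun x => v x ^+ 2) xL xR + (2 * d * sint (fun x => w x * v x) xL xR +
    (2 * d * sint (fun x => v x * q x) xL xR +
     d ^+ 2 * sint (fun x => (1 * q x + 1 * w x) ^+ 2) xL xR)).
  have l1 := locintZ (2 * d) lwv; have l2 := locintZ (2 * d) lvq.
  have l3 := locintZ (d ^+ 2) lqw2; have l23 := locintD l2 l3; have l123 := locintD l1 l23.
  rewrite -!sintZ// -sintD// -sintD// -sintD//.
  by apply: eq_sint => x _ /=; ring.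
have B1 : 2 * `|sint (fun x => v x * q x) xL xR| <=
    eta * sint (fun x => v x ^+ 2) xL xR + eta^-1 * sint (fun x => q x ^+ 2) xL xR.
  have l1 := locintZ eta lv2; have l2 := locintZ eta^-1 lq2.
  apply: (@le_trans _ _ (2 * sint (fun x => `|v x * q x|) xL xR)).
    by rewrite ler_pM2l//; exact: le_norm_sint.
  rewrite -!sintZ//; last exact: locint_norm.
  rewrite -sintD//; apply: le_sint; [exact/locintZ/locint_norm|exact: locintD|].
  move=> x _ /=; rewrite normrM.
  have : 0 <= eta * (`|v x| - eta^-1 * `|q x|) ^+ 2.
    by rewrite mulr_ge0 ?sqr_ge0// ltW.
  rewrite -(real_normK (num_real (v x))) -(real_normK (num_real (q x))).
  have -> : eta * (`|v x| - eta^-1 * `|q x|) ^+ 2 =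
      eta * `|v x| ^+ 2 + eta^-1 * `|q x| ^+ 2 - 2 * (`|v x| * `|q x|).
    by field; rewrite gt_eqF.
  lra.
have B2 : sint (fun x => (1 * q x + 1 * w x) ^+ 2) xL xR <=
    2 * sint (fun x => q x ^+ 2) xL xR + 2 * sint (fun x => w x ^+ 2) xL xR.
  have l1 := locintZ 2 lq2; have l2 := locintZ 2 lw2.
  rewrite -!sintZ// -sintD//; apply: le_sint => //; first exact: locintD.
  by move=> x _ /=; have := sqr_ge0 (q x - w x); rewrite !expr2; lra.
rewrite E; move: B1 B2.
set S := sint (fun x => v x * q x) xL xR; set P := sint (fun x => (1 * q x + 1 * w x) ^+ 2) xL xR.
have P0 : 0 <= P by apply: sint_ge0 => x; exact: sqr_ge0.
move=> B1 B2.
rewrite (_ : _ - _ = d * (2 * S) + d * (d * P)); last by ring.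
apply: le_trans (ler_normD _ _) _.
rewrite !normrM (ger0_norm P0) (ger0_norm (ler0n _ 2)).
by rewrite mulrDr lerD// ler_wpM2l// ler_wpM2l.
Qed.

Definition energy (sigma : R) f : R :=
  sint (fun x => f x ^+ 2) xL xR + sigma * sint (fun x => D f x ^+ 2) xL xR.

Lemma energy_ge0 (sigma : R) f : 0 <= sigma -> 0 <= energy sigma f.
Proof.
by move=> s0; rewrite addr_ge0 ?mulr_ge0// sint_ge0// => x; exact: sqr_ge0.
Qed.

(** The orthogonality of the velocity to [f] removes the first order term of the
    energy increment; what remains is small with the error [e] of the difference
    quotient and with [d]. *)
Lemma energy_increment (sigma : R) f g w (d eta e : R) : xL < xR -> 0 <= sigma ->
  H1p f -> H1p g -> H1p w -> 0 < eta -> d != 0 ->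
  sint (fun x => w x * f x) xL xR + sigma * sint (fun x => D w x * D f x) xL xR = 0 ->
  (H1norm xL xR (fun x => (g x - f x) / d - w x)%R <= (Num.sqrt e)%:E)%E -> 0 <= e ->
  `|energy sigma g - energy sigma f| <=
  `|d| * (eta * energy sigma f + eta^-1 * ((1 + sigma) * e)
     + `|d| * (2 * ((1 + sigma) * e) + 2 * energy sigma w)).
Proof.
move=> xLR s0 fH gH wH eta0 d0.
have ei : 0 <= eta^-1 by rewrite invr_ge0 ltW.
have rearrange (x y z x' y' z' : R) : (x + sigma * x') - (y + sigma * y') =
    (x - y - 2 * d * z) + sigma * (x' - y' - 2 * d * z') + 2 * d * (z + sigma * z').
  by ring.
have final (A A' Q K W W' : R) : Q + K <= e -> 0 <= Q -> 0 <= K ->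
    eta * A + eta^-1 * Q + `|d| * (2 * Q + 2 * W) +
      sigma * (eta * A' + eta^-1 * K + `|d| * (2 * K + 2 * W')) <=
    eta * (A + sigma * A') + eta^-1 * ((1 + sigma) * e)
     + `|d| * (2 * ((1 + sigma) * e) + 2 * (W + sigma * W')).
  move=> QKe Qp Kp; have QK : Q + sigma * K <= (1 + sigma) * e.
    by have := ler_wpM2l s0 QKe; have := mulr_ge0 s0 Qp; lra.
  have h1 := ler_wpM2l ei QK; have h2 := ler_wpM2l (normr_ge0 d) QK; lra.
move=> orth He e0.
have [DfL fD] := weak_derivativeP fH; have [DgL gD] := weak_derivativeP gH.
have [DwL wD] := weak_derivativeP wH.
have [_ fL _] := fH; have [_ gL _] := gH; have [_ wL _] := wH.
have cl h : H1p h -> locint h by case=> ch _ _; exact: continuous_locint.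
have lf := cl _ fH; have lg := cl _ gH; have lw := cl _ wH.
have lDf := L2p_locint xLR DfL; have lDg := L2p_locint xLR DgL; have lDw := L2p_locint xLR DwL.
pose q x := 1 * (d^-1 * g x + (- d^-1) * f x) + (-1) * w x.
pose k x := 1 * (d^-1 * D g x + (- d^-1) * D f x) + (-1) * D w x.
have qH : H1p q by apply: (H1p_linear _ _ xLR _ wH).1; exact: (H1p_linear _ _ xLR gH fH).1.
have kL : L2p k by apply: L2p_linear => //; exact: L2p_linear.
have qk : is_weak_derivative q k.
  have l1 := locintD (locintZ d^-1 lg) (locintZ (- d^-1) lf).
  have l2 := locintD (locintZ d^-1 lDg) (locintZ (- d^-1) lDf).
  by apply: is_weak_derivative_linear => //; exact: is_weak_derivative_linear.
have [_ qL _] := qH.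
have qE : (fun x => (g x - f x) / d - w x) = q by apply/funext => x; rewrite /q; ring.
have Q0 : 0 <= sint (fun x => q x ^+ 2) xL xR by apply: sint_ge0 => x; exact: sqr_ge0.
have K0 : 0 <= sint (fun x => k x ^+ 2) xL xR by apply: sint_ge0 => x; exact: sqr_ge0.
move: He; rewrite qE (H1norm_sqr xLR qH kL qk) lee_fin ler_sqrt// => He.
have Eg : sint (fun x => g x ^+ 2) xL xR = sint (fun x => (f x + d * (q x + w x)) ^+ 2) xL xR.
  by apply: eq_sint => x _; rewrite /q; congr (_ ^+ 2); field.
have EDg : sint (fun x => D g x ^+ 2) xL xR =
    sint (fun x => (D f x + d * (k x + D w x)) ^+ 2) xL xR.
  by apply: eq_sint => x _; rewrite /k; congr (_ ^+ 2); field.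
have I1 := quadratic_increment d xLR fL qL wL eta0.
have I2 := quadratic_increment d xLR DfL kL DwL eta0.
rewrite -Eg in I1; rewrite -EDg in I2.
have -> : energy sigma g - energy sigma f =
  (sint (fun x => g x ^+ 2) xL xR - sint (fun x => f x ^+ 2) xL xR
    - 2 * d * sint (fun x => w x * f x) xL xR) +
  sigma * (sint (fun x => D g x ^+ 2) xL xR - sint (fun x => D f x ^+ 2) xL xR
    - 2 * d * sint (fun x => D w x * D f x) xL xR) +
  2 * d * (sint (fun x => w x * f x) xL xR + sigma * sint (fun x => D w x * D f x) xL xR).
  exact: rearrange.
rewrite orth mulr0 addr0.
apply: le_trans (ler_normD _ _) _; rewrite normrM (ger0_norm s0).
apply: le_trans (lerD I1 (ler_wpM2l s0 I2)) _.
rewrite mulrCA -mulrDr ler_wpM2l//.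
exact: final.
Qed.

(** The constants make each of the three summands at most e / 3. *)
Lemma increment_choice (A B sigma e : R) : 0 <= A -> 0 <= B -> 0 <= sigma -> 0 < e ->
  exists eta e1 r, [/\ 0 < eta, 0 < e1, 0 < r & forall d, d < r ->
    eta * A + eta^-1 * ((1 + sigma) * e1) + d * (2 * ((1 + sigma) * e1) + 2 * B) <= e].
Proof.
move=> A0 B0 s0 e0.
have s10 : 0 < 1 + sigma by lra.
pose eta := e / (3 * (A + 1)).
have A1 : 0 < 3 * (A + 1) by lra.
have eta0 : 0 < eta by rewrite divr_gt0.
pose m := Num.min 1 (eta * e / 3).
have ee0 : 0 < eta * e by rewrite mulr_gt0.
have m0 : 0 < m by rewrite lt_min ltr01 divr_gt0.
have m1 : m <= 1 by rewrite ge_min lexx.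
have m2 : m <= eta * e / 3 by rewrite ge_min lexx orbT.
have B1 : 0 < 3 * (2 + 2 * B) by lra.
exists eta, (m / (1 + sigma)), (e / (3 * (2 + 2 * B))).
split; rewrite ?divr_gt0// => d dr.
have -> : (1 + sigma) * (m / (1 + sigma)) = m by rewrite mulrC mulfVK// gt_eqF.
have t1 : eta * A <= e / 3.
  have : eta * (3 * (A + 1)) = e by rewrite /eta mulfVK// gt_eqF.
  lra.
have t2 : eta^-1 * m <= e / 3.
  by rewrite -(@ler_pM2l _ eta)// mulrA mulfV ?gt_eqF// mul1r mulrA.
have t3 : d * (2 * m + 2 * B) <= e / 3.
  have [d0|d0] := leP d 0.
    apply: (@le_trans _ _ 0); last lra.
    by rewrite mulr_le0_ge0//; lra.
  apply: (@le_trans _ _ (e / (3 * (2 + 2 * B)) * (2 + 2 * B))).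
    by apply: ler_pM; lra.
  by rewrite le_eqVlt; apply/orP; left; apply/eqP; field; lra.
lra.
Qed.

(** The energy has derivative 0 in time. Composing with the projection [clamp] onto
    [0, T], which is 1-Lipschitz, turns the one-sided derivatives at 0 and [T] into
    derivatives on the whole line. *)
Lemma energy_conservation (T a sigma gamma : R) (u0 : R -> R) (u : R -> R -> R) :
  xL < xR -> 0 < T -> 0 < sigma ->
  RLW_exact_solution xL xR a sigma gamma T u0 u ->
  forall t, t \in `[0, T]%R -> H1p (u t) /\ energy sigma (u t) = energy sigma u0.
Proof.
move=> xLR T0 s0 [u' C1 [eqn init]] t tT.
have [uH _ _ _] := C1 t tT; split; first exact: uH.
pose clamp s := Num.max 0 (Num.min T s).
have clampT s : clamp s \in `[0, T]%R.
  by rewrite in_itv/= /clamp le_max lexx/= ge_max ge_min lexx (ltW T0).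
have clampK s : s \in `[0, T]%R -> clamp s = s.
  by rewrite in_itv/= /clamp => /andP[s1 s2]; rewrite (min_idPr s2) (max_idPr s1).
have clamp_lip s r : `|clamp s - clamp r| <= `|s - r|.
  have h1 := ler_norm (s - r); have h2 := ler_norm (r - s); rewrite (distrC r s) in h2.
  have h3 := normr_ge0 (s - r); rewrite /clamp.
  case: (leP T s) => h4; case: (leP T r) => h5; rewrite ?(max_r (ltW T0)) ?subrr ?normr0//;
    do ?[case: (leP 0 s) => h6]; do ?[case: (leP 0 r) => h7];
    rewrite ler_norml; apply/andP; split; lra.
have -> : u0 = u 0 by apply/funext => x; rewrite init.
have zT : 0 \in `[0, T]%R by rewrite in_itv/= lexx ltW.
rewrite -(clampK _ tT) -(clampK _ zT).
apply: (@is_derive_0_is_cst _ (fun s => energy sigma (u (clamp s)))) => {uH t tT zT} r.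
apply: is_derive_of_bound => e e0.
set t := clamp r; have tT : t \in `[0, T]%R by exact: clampT.
have [uH vH Q _] := C1 t tT.
have orth := energy_identity xLR uH vH (eqn t tT).
have [eta [e1 [r2 [eta0 e10 r20 choice]]]] := increment_choice
  (energy_ge0 (u t) (ltW s0)) (energy_ge0 (u' t) (ltW s0)) (ltW s0) e0.
have sq0 : 0 < Num.sqrt e1 by rewrite sqrtr_gt0.
have [r1 r10 Hr1] : exists2 r1, 0 < r1 & forall s, s \in `[0, T]%R -> s != t -> `|s - t| < r1 ->
    (H1norm xL xR (fun x => (u s x - u t x) / (s - t) - u' t x)%R <= (Num.sqrt e1)%:E)%E.
  move: Q => /fine_cvgP[Qf /cvgrPdist_lt/(_ _ sq0) Qd].
  pose Hn s := H1norm xL xR (fun x => (u s x - u t x) / (s - t) - u' t x).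
  have /nbhs_ballP[r1/= r10 Hr1] : nbhs t [set s | s != t -> s \in `[0, T]%R ->
      Hn s \is a fin_num /\ `|0 - fine (Hn s)| < Num.sqrt e1].
    exact: (filterI Qf Qd).
  exists r1 => // s sT st sr.
  have tsr : ball t r1 s by rewrite /ball/= distrC.
  have [Hf Hd] := Hr1 s tsr st sT.
  rewrite -/(Hn s) -(fineK Hf) lee_fin ltW//; apply: le_lt_trans Hd.
  by rewrite sub0r normrN; exact: ler_norm.
exists (Num.min r1 r2); first by rewrite lt_min r10.
move=> y yr; rewrite mul0r subr0 -/t; set s := clamp y.
have sy : `|s - t| <= `|y - r| by exact: clamp_lip.
have [->|st] := eqVneq s t; first by rewrite subrr normr0 mulr_ge0// ltW.
have := le_lt_trans sy yr; rewrite lt_min => /andP[sr1 sr2].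
have sT : s \in `[0, T]%R by exact: clampT.
have [usH _ _ _] := C1 s sT.
have d0 : s - t != 0 by rewrite subr_eq0.
have := energy_increment xLR (ltW s0) uH usH vH eta0 d0 orth (Hr1 s sT st sr1) (ltW e10).
move/le_trans; apply.
apply: (@le_trans _ _ (`|s - t| * e)); last by rewrite mulrC ler_wpM2l// ltW.
rewrite ler_wpM2l//.
exact: choice.
Qed.

End EnergyConservation.

(** * Fourier differentiation matrices *)

Section TrigInequalities.
Context {R : realType}.
Implicit Types (x t : R).

Lemma sqr_sin_le x : sin x ^+ 2 <= x ^+ 2.
Proof.
wlog x0 : x / 0 <= x.
  move=> H; have [/H//|x0] := leP 0 x.
  by have := H (- x); rewrite sinN !sqrrN; apply; rewrite oppr_ge0 ltW.
have lc := continuous_locint (@continuous_cos R).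
have := sint_is_derive x0 (@is_derive_sin R) (@continuous_cos R).
rewrite sin0 subr0 => E.
have h1 : sin x <= x.
  rewrite -E -[leRHS]mul1r -{2}[x]subr0 -sint_cst//; apply: le_sint => [||z _]; last exact: cos_le1.
    exact: lc.
  by apply: continuous_locint => z; exact: cvg_cst.
have h2 : - x <= sin x.
  rewrite -E -[leLHS]mulN1r -{1}[x]subr0 -sint_cst//; apply: le_sint => [||z _]; last exact: cos_geN1.
    by apply: continuous_locint => z; exact: cvg_cst.
  exact: lc.
have : 0 <= (x - sin x) * (x + sin x) by apply: mulr_ge0; lra.
by rewrite !expr2; lra.
Qed.

(** If cos x >= 1/2, then x <= 2 sin x because x cos x <= sin x; otherwise
    sin^2 x >= 3/4 while x^2 <= 4. *)
Lemma le_sqr_sin x : `|x| <= pi / 2 -> x ^+ 2 <= 16 / 3 * sin x ^+ 2.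
Proof.
wlog x0 : x / 0 <= x.
  move=> H; have [/H//|x0] := leP 0 x => hx.
  by have := H (- x); rewrite sinN !sqrrN normrN; apply => //; rewrite oppr_ge0 ltW.
rewrite ger0_norm// => xpi.
have pi4 := @pihalf_lt2 R.
have sin_ge0' z : 0 <= z <= x -> 0 <= sin z.
  move=> /andP[z0 zx]; apply: sin_ge0_pi; rewrite z0/=; have := @pi_ge0 R; lra.
have tangent : x * cos x <= sin x.
  have d (z : R) : is_derive z 1 (fun y => sin y - y * cos y) (z * sin z).
    have did : is_derive z 1 (@id R) 1 by exact: is_derive_id.
    have := is_deriveB (is_derive_sin z) (is_deriveM did (is_derive_cos z)).
    by move=> /is_derive_eq; apply; rewrite /GRing.scale/=; ring.
  have cz : continuous (fun z : R => z * sin z).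
    by move=> z; apply: cvgM; [exact: cvg_id|exact: continuous_sin].
  have := sint_is_derive x0 d cz; rewrite sin0 mul0r !subr0 => E.
  rewrite -subr_ge0 -E; apply: Rintegral_ge0 => z; rewrite /= in_itv/= => zx.
  by rewrite mulr_ge0 ?sin_ge0'//; case/andP: zx.
have s0 : 0 <= sin x by apply: sin_ge0'; rewrite x0 lexx.
have [c1|c1] := leP (1 / 2) (cos x).
  have h : x <= 2 * sin x by have := ler_wpM2l x0 c1; lra.
  have : x ^+ 2 <= (2 * sin x) ^+ 2 by rewrite ler_pXn2r// nnegrE mulr_ge0.
  by have := sqr_ge0 (sin x); rewrite !expr2; lra.
have c0 : 0 <= cos x by apply: cos_ge0_pihalf; rewrite xpi andbT; lra.
have : cos x ^+ 2 <= (1/2) ^+ 2.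
  by rewrite ler_pXn2r ?nnegrE// ?(ltW c1)//; lra.
have : x ^+ 2 <= 2 ^+ 2 by rewrite ler_pXn2r ?nnegrE//; lra.
have := cos2Dsin2 x; lra.
Qed.

End TrigInequalities.

Section Fourier.
Context {R : realType}.
Variables (xL xR : R) (N : nat).
Local Notation L := (xR - xL).
Local Notation h := (mesh xL xR N).
Local Notation x_ := (node xL xR N).
Local Notation M := (N./2).

(** The wave numbers -N/2, ..., N/2 are indexed by m = 0, ..., N. *)
Definition waven (m : nat) : int := m%:Z - (N./2)%:Z.

Definition wfreq (m : nat) : R := (waven m)%:~R * (2 * pi / (xR - xL)).

Definition wcoef (m : nat) : R := (fourier_weight N (waven m))^-1.

Lemma Re_fourier_basis l x : complex.Re (fourier_basis xL xR N l x) =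
  N%:R^-1 * \sum_(m < N.+1) wcoef m * cos (wfreq m * (x - x_ l)).
Proof.
have FRe (c : R) (z : R[i]) : complex.Re (c%:C%C * z) = c * complex.Re z.
  by case: z => p q /=; rewrite mul0r subr0.
rewrite /fourier_basis FRe raddf_sum; congr (_ * _).
apply: eq_bigr => m _; rewrite -[LHS]/(complex.Re (fourier_mode xL xR N l x (waven m))).
by rewrite /fourier_mode FRe.
Qed.

Lemma is_derive_cos_aff (k b z : R) :
  is_derive z 1 (fun x => cos (k * (x - b))) (- k * sin (k * (z - b))).
Proof.
have aff : is_derive z 1 (fun x => k * (x - b)) k.
  rewrite (_ : (fun x => _) = (k *: (@id R - cst b))); last exact/funext.
  by apply: is_derive_eq; rewrite subr0 /GRing.scale/= mulr1.
have := @is_derive1_comp _ cos (fun x => k * (x - b)) z _ _ (is_derive_cos _) aff.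
by move=> /is_derive_eq; apply; ring.
Qed.

Lemma is_derive_sin_aff (k b z : R) :
  is_derive z 1 (fun x => sin (k * (x - b))) (k * cos (k * (z - b))).
Proof.
have aff : is_derive z 1 (fun x => k * (x - b)) k.
  rewrite (_ : (fun x => _) = (k *: (@id R - cst b))); last exact/funext.
  by apply: is_derive_eq; rewrite subr0 /GRing.scale/= mulr1.
have := @is_derive1_comp _ sin (fun x => k * (x - b)) z _ _ (is_derive_sin _) aff.
by move=> /is_derive_eq; apply; ring.
Qed.

Lemma is_derive_combination n (c : R) (f df : 'I_n -> R -> R) (z : R) :
  (forall m, is_derive z 1 (f m) (df m z)) ->
  is_derive z 1 (fun x => c * \sum_(m < n) f m x) (c * \sum_(m < n) df m z).
Proof.
move=> fd; have -> : (fun x => c * \sum_(m < n) f m x) = c *: (\sum_(m < n) f m).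
  by apply/funext => x; rewrite /GRing.scale/= fct_sumE.
by apply: is_deriveZ.
Qed.

Lemma fourier_diff1E j l : fourier_diff xL xR N 1 j l =
  N%:R^-1 * \sum_(m < N.+1) wcoef m * (- wfreq m * sin (wfreq m * (x_ j - x_ l))).
Proof.
rewrite mxE /derive1n/=; apply: is_derive_derive1.
have -> : (fun x => complex.Re (fourier_basis xL xR N l x)) =
   (fun x => N%:R^-1 * \sum_(m < N.+1) wcoef m * cos (wfreq m * (x - x_ l))).
  by apply/funext => x; exact: Re_fourier_basis.
apply: (@is_derive_combination _ _ _ (fun m z => wcoef m * (- wfreq m * sin (wfreq m * (z - x_ l))))) => m.
exact: is_deriveZ (is_derive_cos_aff _ _ _).
Qed.

Lemma fourier_diff2E j l : fourier_diff xL xR N 2 j l =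
  - (N%:R^-1 * \sum_(m < N.+1) wcoef m * (wfreq m ^+ 2 * cos (wfreq m * (x_ j - x_ l)))).
Proof.
rewrite mxE /derive1n/=.
have -> : (fun x => complex.Re (fourier_basis xL xR N l x))^`()%classic =
   (fun x => N%:R^-1 * \sum_(m < N.+1) (wcoef m * - wfreq m) * sin (wfreq m * (x - x_ l))).
  apply/funext => z; apply: is_derive_derive1.
  have -> : (fun x => complex.Re (fourier_basis xL xR N l x)) =
    (fun x => N%:R^-1 * \sum_(m < N.+1) wcoef m * cos (wfreq m * (x - x_ l))).
    by apply/funext => x; exact: Re_fourier_basis.
  apply: (@is_derive_combination _ _ _ (fun m z => wcoef m * - wfreq m * sin (wfreq m * (z - x_ l)))) => m.
  by rewrite -mulrA; exact: is_deriveZ (is_derive_cos_aff _ _ _).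
apply: is_derive_derive1; rewrite -mulrN -sumrN.
apply: (@is_derive_combination _ _ _ (fun m z => - (wcoef m * (wfreq m ^+ 2 * cos (wfreq m * (z - x_ l)))))) => m.
have := is_deriveZ (wcoef m * - wfreq m) (is_derive_sin_aff (wfreq m) (x_ l) (x_ j)).
by move=> /is_derive_eq; apply; rewrite /GRing.scale/=; ring.
Qed.

Lemma tr_fourier_diff1 : (fourier_diff xL xR N 1)^T = - fourier_diff xL xR N 1.
Proof.
apply/matrixP => j l; rewrite [LHS]mxE [RHS]mxE !fourier_diff1E -mulrN -sumrN.
congr (_ * _); apply: eq_bigr => m _.
by rewrite -(opprB (x_ j)) mulrN sinN; ring.
Qed.

Lemma tr_fourier_diff2 : (fourier_diff xL xR N 2)^T = fourier_diff xL xR N 2.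
Proof.
apply/matrixP => j l; rewrite [LHS]mxE !fourier_diff2E.
congr (- (_ * _)); apply: eq_bigr => m _.
by rewrite -(opprB (x_ j)) mulrN cosN.
Qed.


(** The squared modulus of a discrete Fourier coefficient of [V], written without
    complex numbers. *)
Definition spectral (V : 'I_N -> R) (m : nat) : R :=
  (\sum_(j < N) V j * cos (wfreq m * x_ j)) ^+ 2 +
  (\sum_(j < N) V j * sin (wfreq m * x_ j)) ^+ 2.

Lemma spectral_ge0 V m : 0 <= spectral V m.
Proof. by rewrite addr_ge0 ?sqr_ge0. Qed.

Lemma wcoef_ge0 m : 0 <= wcoef m.
Proof. by rewrite invr_ge0 /fourier_weight; case: ifP. Qed.

Lemma double_sum (V : 'I_N -> R) (F : 'I_N -> R) :
  (\sum_j V j * F j) ^+ 2 = \sum_j \sum_l V j * V l * (F j * F l).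
Proof.
rewrite expr2 big_distrl/=; apply: eq_bigr => j _.
by rewrite big_distrr/=; apply: eq_bigr => l _; ring.
Qed.

Lemma spectralE V m :
  spectral V m = \sum_j \sum_l V j * V l * cos (wfreq m * (x_ j - x_ l)).
Proof.
rewrite /spectral !double_sum -big_split/=; apply: eq_bigr => j _.
rewrite -big_split/=; apply: eq_bigr => l _.
by rewrite -mulrDr -cosB -mulrBr.
Qed.

(** Quadratic forms whose matrix is a combination of the cosines
    cos(k_m (x_j - x_l)) are diagonal in the Fourier coefficients. *)
Lemma spectral_combine (V : 'I_N -> R) (w : nat -> R) :
  \sum_j \sum_l V j * V l * (N%:R^-1 * \sum_(m < N.+1) wcoef m * (w m * cos (wfreq m * (x_ j - x_ l))))
  = N%:R^-1 * \sum_(m < N.+1) wcoef m * (w m * spectral V m).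
Proof.
transitivity (\sum_(m < N.+1) \sum_j \sum_l
    N%:R^-1 * (wcoef m * (w m * (V j * V l * cos (wfreq m * (x_ j - x_ l)))))); last first.
  rewrite mulr_sumr; apply: eq_bigr => m _; rewrite spectralE !mulr_sumr; apply: eq_bigr => j _.
  by rewrite !mulr_sumr; apply: eq_bigr => l _.
rewrite [RHS]exchange_big/=; apply: eq_bigr => j _.
rewrite [RHS]exchange_big/=; apply: eq_bigr => l _.
by rewrite !mulr_sumr; apply: eq_bigr => m _; ring.
Qed.

Lemma dotgE (U V : 'cV[R]_N) : dotg xL xR U V = h * (U^T *m V) 0 0.
Proof. by rewrite /dotg mxE; congr (_ * _); apply: eq_bigr => j _; rewrite mxE. Qed.

Lemma dotg_diff2 (V : 'cV[R]_N) :
  dotg xL xR (- (fourier_diff xL xR N 2 *m V)) V =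
  h * (N%:R^-1 * \sum_(m < N.+1) wcoef m * (wfreq m ^+ 2 * spectral (fun j => V j 0) m)).
Proof.
rewrite /dotg -(spectral_combine _ (fun m => wfreq m ^+ 2)); congr (_ * _).
apply: eq_bigr => j _; rewrite !mxE -sumrN mulr_suml; apply: eq_bigr => l _.
by rewrite fourier_diff2E; ring.
Qed.

End Fourier.

Section DiscreteOrthogonality.
Context {R : realType}.
Variables (N : nat).

(** At the differences of two node indices this is the discrete Dirichlet kernel, a
    Kronecker delta modulo N. *)
Definition dirichlet (t : R) : R := N%:R^-1 *
  \sum_(m < N.+1) wcoef N m * cos ((waven N m)%:~R * (2 * pi / N%:R * t)).

Lemma dirichletN t : dirichlet (- t) = dirichlet t.
Proof. by congr (_ * _); apply: eq_bigr => m _; rewrite !mulrN cosN. Qed.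

Hypotheses (N0 : (0 < N)%N) (evenN : ~~ odd N).

Lemma waven0 : waven N 0 = - (N./2)%:Z.
Proof. by rewrite /waven sub0r. Qed.

Lemma wavenN : waven N N = (N./2)%:Z.
Proof. by rewrite /waven -[in X in X%:Z - _](even_halfK evenN) -addnn PoszD addrK. Qed.

(** The weights 1/2 at the two extreme wave numbers are those of the trapezoidal
    rule. *)
Lemma trapezoid (F : nat -> R) :
  \sum_(m < N.+1) (wcoef N m : R) * F m = \sum_(m < N) (F m + F m.+1) / 2.
Proof.
have w0 : wcoef N 0 = 1 / 2 :> R by rewrite /wcoef waven0 /fourier_weight abszN eqxx div1r.
have wN : wcoef N N = 1 / 2 :> R by rewrite /wcoef wavenN /fourier_weight eqxx div1r.
have wm m : (0 < m < N)%N -> wcoef N m = 1 :> R.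
  move=> mN; rewrite /wcoef /fourier_weight ifF ?invr1// /waven.
  have := even_halfK evenN; rewrite -addnn; lia.
case: N N0 w0 wN wm => // n _ w0 wN wm.
rewrite big_ord_recl big_ord_recr/= w0 /bump/= ?add1n wN.
rewrite -mulr_suml big_split/= [X in _ = (X + _) / 2]big_ord_recl/=.
rewrite [X in _ = (_ + X) / 2]big_ord_recr/=.
rewrite (eq_bigr (fun i : 'I_n => F i.+1)); last first.
  by move=> i _; rewrite wm ?mul1r//= /bump/= ?add1n ltnS ltn_ord.
rewrite [X in (_ + X + _) / 2](eq_bigr (fun i : 'I_n => F i.+1))//.
by field.
Qed.

End DiscreteOrthogonality.

(** * Spectral and finite differences *)

Section DirichletValues.
Context {R : realType}.
Variables (N : nat).
Hypotheses (N0 : (0 < N)%N) (evenN : ~~ odd N).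
Local Notation P := (@dirichlet R N).

Lemma sin_mulpi (k : nat) : sin (k%:R * pi) = 0 :> R.
Proof.
elim: k => [|k IH]; first by rewrite mul0r sin0.
by rewrite -natr1 mulrDl mul1r sinDpi IH oppr0.
Qed.

Lemma cos_mul2pi (k : int) : cos (k%:~R * (2 * pi)) = 1 :> R.
Proof.
have -> : 2 * pi = pi *+ 2 :> R by rewrite mulr_natl.
have H (n : nat) : cos (n%:R * (pi *+ 2)) = 1 :> R.
  elim: n => [|n IH]; first by rewrite mul0r cos0.
  by rewrite -natr1 mulrDl mul1r cosD2pi.
case: k => n; first exact: H.
by rewrite NegzE mulrNz mulNr cosN -[X in X * _]/(n.+1%:R) H.
Qed.

Lemma dirichlet_cst t :
  (forall m, cos ((waven N m)%:~R * (2 * pi / N%:R * t)) = 1) -> P t = 1.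
Proof.
move=> H; rewrite /dirichlet.
rewrite (trapezoid N0 evenN (fun m => cos ((waven N m)%:~R * (2 * pi / N%:R * t)))).
rewrite (eq_bigr (fun=> 1)); last by move=> m _; rewrite !H; field.
by rewrite sumr_const card_ord mulVf// pnatr_eq0 -lt0n.
Qed.

Lemma dirichlet0 : P 0 = 1.
Proof. by apply: dirichlet_cst => m; rewrite !mulr0 cos0. Qed.

Lemma dirichlet_period : P N%:R = 1.
Proof.
apply: dirichlet_cst => m; rewrite mulfVK ?cos_mul2pi//.
by rewrite pnatr_eq0 -lt0n.
Qed.

(** Multiplied by sin(th / 2), with th = 2 pi k / N, the trapezoidal sum telescopes
    to a multiple of sin(k pi) = 0. *)
Lemma dirichlet_eq0 k : (0 < k < N)%N -> P k%:R = 0.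
Proof.
move=> /andP[k0 kN]; rewrite /dirichlet.
set th : R := 2 * pi / N%:R * k%:R.
rewrite (trapezoid N0 evenN (fun m => cos ((waven N m)%:~R * th))).
have NR : 0 < N%:R :> R by rewrite ltr0n.
have s0 : 0 < sin (th / 2).
  have kR : 0 < k%:R :> R by rewrite ltr0n.
  have -> : th / 2 = pi * (k%:R / N%:R) by rewrite /th; field; rewrite gt_eqF.
  apply: sin_gt0_pi; rewrite mulr_gt0 ?divr_gt0 ?pi_gt0//=.
  by rewrite gtr_pMr ?pi_gt0// ltr_pdivrMr// mul1r ltr_nat.
suff : sin (th / 2) * (\sum_(m < N) (cos ((waven N m)%:~R * th) +
    cos ((waven N m.+1)%:~R * th)) / 2) = 0.
  by move/eqP; rewrite mulf_eq0 gt_eqF//= => /eqP ->; rewrite mulr0.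
rewrite mulr_sumr.
rewrite (eq_bigr (fun m : 'I_N => cos (th / 2) / 2 *
    (sin ((waven N m.+1)%:~R * th) - sin ((waven N m)%:~R * th)))); last first.
  move=> m _; have -> : (waven N m.+1)%:~R = (waven N m)%:~R + 1 :> R.
    by rewrite (_ : waven N m.+1 = waven N m + 1) ?intrD// /waven; lia.
  set w : R := (waven N m)%:~R.
  have [al [-> ->]] : exists al, (w + 1) * th = al + th / 2 /\ w * th = al - th / 2.
    by exists (w * th + th / 2); split; field.
  by rewrite sinB sinD cosB cosD; field.
rewrite -mulr_sumr -(big_mkord xpredT (fun m => sin ((waven N m.+1)%:~R * th) - sin ((waven N m)%:~R * th))).
rewrite telescope_sumr// waven0 wavenN// mulrNz mulNr sinN.
suff -> : (N./2)%:Z%:~R * th = k%:R * pi by rewrite sin_mulpi oppr0 subrr mulr0.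
rewrite /th -{2}(even_halfK evenN) -muln2 natrM; field.
by rewrite pnatr_eq0; move: (even_halfK evenN) N0; case: (N./2) => // <-.
Qed.

Lemma dirichlet_ord (j l : 'I_N) : P (j%:R - l%:R) = (j == l)%:R.
Proof.
wlog jl : j l / (l <= j)%N.
  move=> H; have [/H//|/ltnW lj] := leqP l j.
  by rewrite -opprB dirichletN H// eq_sym.
have [->|njl] := eqVneq j l; first by rewrite subrr dirichlet0.
rewrite -natrB// dirichlet_eq0// subn_gt0; have jN := ltn_ord j.
rewrite (leq_ltn_trans (leq_subr _ _) jN) andbT ltn_neqAle jl andbT.
by apply: contraNneq njl => e; apply/eqP/val_inj.
Qed.

Lemma dirichlet_ordS (j l : 'I_N) : P (j%:R - l%:R + 1) = (l == ordS j)%:R.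
Proof.
have jN := ltn_ord j; have lN := ltn_ord l.
have [e|ne] := eqVneq l (ordS j).
  have [jl|jl] := ltnP j.+1 N.
    have -> : l = j.+1 :> nat by rewrite e/= modn_small.
    by rewrite -natr1 opprD addrA subrr sub0r addNr dirichlet0.
  have jE : j.+1 = N by apply/eqP; rewrite eqn_leq jl jN.
  have -> : l = 0%N :> nat by rewrite e/= jE modnn.
  by rewrite subr0 natr1 jE dirichlet_period.
have [lj|jl] := leqP l j.
  rewrite -natrB// natr1 dirichlet_eq0//= ltn_neqAle.
  rewrite (leq_trans _ jN) ?ltnS ?leq_subr// andbT.
  apply: contraNneq ne => e.
  have [l0 jE] : l = 0%N :> nat /\ j.+1 = N by lia.
  by apply/eqP/val_inj; rewrite /= jE modnn.
have jlt : (j.+1 < l)%N.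
  rewrite ltn_neqAle jl andbT; apply: contraNneq ne => e.
  by apply/eqP/val_inj; rewrite /= e modn_small.
have -> : j%:R - l%:R + 1 = - (l - j.+1)%:R :> R.
  by rewrite natrB ?(ltnW jlt)// -natr1; ring.
by rewrite dirichletN dirichlet_eq0//; lia.
Qed.

Lemma sum_indicator (F : 'I_N -> R) (a : 'I_N) :
  \sum_l F l * (l == a)%:R = F a.
Proof.
rewrite (bigD1 a)//= eqxx mulr1 big1 ?addr0// => i /negbTE ->.
by rewrite mulr0.
Qed.

End DirichletValues.

Section Differences.
Context {R : realType}.
Variables (xL xR : R) (N : nat).
Local Notation h := (mesh xL xR N).
Local Notation x_ := (node xL xR N).
Local Notation kap := (wfreq xL xR N).
Implicit Types (V : 'I_N -> R).

(** The differences are cyclic, as [ordS] wraps around. *)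
Definition sqdiff V : R := \sum_j (V (ordS j) - V j) ^+ 2.

(** By orthogonality of the Fourier modes: (2 - 2 cos b) cos t is
    2 cos t - cos (t + b) - cos (t - b), so that the right-hand side is a combination
    of Dirichlet kernels at j - l, j - l + 1 and j - l - 1. *)
Lemma sqdiffE V : xL < xR -> (0 < N)%N -> ~~ odd N ->
  sqdiff V = N%:R^-1 *
    \sum_(m < N.+1) wcoef N m * ((2 - 2 * cos (kap m * h)) * spectral xL xR V m).
Proof.
move=> xLR N0 evenN.
have NR : N%:R != 0 :> R by rewrite pnatr_eq0 -lt0n.
have LR : xR - xL != 0 by rewrite subr_eq0 gt_eqF.
rewrite -(spectral_combine xL xR V (fun m => 2 - 2 * cos (kap m * h))).
have inner (j l : 'I_N) : N%:R^-1 * \sum_(m < N.+1) wcoef N m *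
    ((2 - 2 * cos (kap m * h)) * cos (kap m * (x_ j - x_ l))) =
    2 * (j == l)%:R - (l == ordS j)%:R - (j == ordS l)%:R.
  transitivity (2 * dirichlet N (j%:R - l%:R) - dirichlet N (j%:R - l%:R + 1) -
    dirichlet N (- (l%:R - j%:R + 1)) : R); last first.
    by rewrite dirichletN dirichlet_ord// !dirichlet_ordS.
  rewrite /dirichlet !(mulrCA 2) -!mulrBr; congr (_ * _).
  rewrite mulr_sumr -!sumrB; apply: eq_bigr => m _.
  have -> : kap m * h = (waven N m)%:~R * (2 * pi / N%:R).
    by rewrite /wfreq /mesh; field; rewrite NR LR.
  have -> : kap m * (x_ j - x_ l) = (waven N m)%:~R * (2 * pi / N%:R) * (j%:R - l%:R).
    by rewrite /wfreq /node /mesh; field; rewrite NR LR.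
  set b : R := (waven N m)%:~R * (2 * pi / N%:R).
  rewrite (mulrA _ (2 * pi / N%:R)) -/b (mulrA _ (2 * pi / N%:R)) -/b (mulrA _ (2 * pi / N%:R)) -/b.
  have -> : b * (j%:R - l%:R + 1) = b * (j%:R - l%:R) + b by ring.
  have -> : b * - (l%:R - j%:R + 1) = b * (j%:R - l%:R) - b by ring.
  by rewrite cosB cosD; ring.
under eq_bigr => j _ do under eq_bigr => l _ do rewrite inner.
have -> : \sum_j \sum_l V j * V l * (2 * (j == l)%:R - (l == ordS j)%:R - (j == ordS l)%:R) =
   \sum_j \sum_l (2 * (V j * V l) * (l == j)%:R) - \sum_j \sum_l (V j * V l * (l == ordS j)%:R)
   - \sum_l \sum_j (V j * V l * (j == ordS l)%:R).
  rewrite [X in _ = _ - X]exchange_big/= -!sumrB; apply: eq_bigr => j _.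
  by rewrite -!sumrB; apply: eq_bigr => l _; rewrite (eq_sym l j); ring.
under [X in _ = X - _ - _]eq_bigr => j _ do rewrite (sum_indicator (fun l => 2 * (V j * V l))).
under [X in _ = _ - X - _]eq_bigr => j _ do rewrite (sum_indicator (fun l => V j * V l)).
under [X in _ = _ - _ - X]eq_bigr => l _ do rewrite (sum_indicator (fun j => V j * V l)).
have shift : \sum_j V (ordS j) ^+ 2 = \sum_j V j ^+ 2.
  by rewrite [RHS](reindex_inj (@ordS_inj N)).
rewrite /sqdiff (eq_bigr (fun j => V (ordS j) ^+ 2 + (V j ^+ 2 -
   (V j * V (ordS j)) - (V (ordS j) * V j)))); last by move=> j _; ring.
rewrite big_split/= shift !sumrB.
rewrite [X in _ = X - _ - _](eq_bigr (fun j => 2 * V j ^+ 2)); last first.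
  by move=> j _; rewrite expr2.
by rewrite -mulr_sumr; ring.
Qed.

Lemma mesh_gt0 : xL < xR -> (0 < N)%N -> 0 < h.
Proof. by move=> xLR N0; rewrite divr_gt0 ?subr_gt0 ?ltr0n. Qed.

(** 2 - 2 cos(k h) = 4 sin^2(k h / 2), and |k h / 2| <= pi / 2 for the wave numbers
    that the grid resolves. *)
Lemma symbol_bounds m : xL < xR -> (0 < N)%N -> ~~ odd N -> (m <= N)%N ->
  2 - 2 * cos (kap m * h) <= h ^+ 2 * kap m ^+ 2 <= 16 / 3 * (2 - 2 * cos (kap m * h)).
Proof.
move=> xLR N0 evenN mN.
have NR : 0 < N%:R :> R by rewrite ltr0n.
have L0 : 0 < xR - xL by rewrite subr_gt0.
set t := kap m * h / 2.
have -> : kap m * h = t + t by rewrite /t; field.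
have -> : h ^+ 2 * kap m ^+ 2 = 4 * t ^+ 2 by rewrite /t; field.
have -> : 2 - 2 * cos (t + t) = 4 * sin t ^+ 2.
  by rewrite cosD -!expr2 cos2sin2; ring.
rewrite ler_pM2l// sqr_sin_le/= (mulrCA (16 / 3)) ler_pM2l//; apply: le_sqr_sin.
have -> : t = (waven N m)%:~R * (pi / N%:R).
  by rewrite /t /wfreq /mesh; field; rewrite !gt_eqF.
rewrite normrM [X in _ * X]ger0_norm; last by rewrite divr_ge0 ?pi_ge0.
have w : `|(waven N m)%:~R| <= N%:R / 2 :> R.
  have -> : N%:R / 2 = (N./2)%:R :> R.
    by rewrite -{1}(even_halfK evenN) -muln2 natrM; field.
  rewrite -intr_norm -[leRHS]/((N./2)%:Z%:~R) ler_int /waven.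
  by have := even_halfK evenN; rewrite -addnn; lia.
apply: (@le_trans _ _ (N%:R / 2 * (pi / N%:R))).
  by rewrite ler_wpM2r// divr_ge0 ?pi_ge0.
by rewrite le_eqVlt; apply/orP; left; apply/eqP; field; rewrite gt_eqF.
Qed.

Lemma seminorm_sqr (V : 'cV[R]_N) : xL < xR -> (0 < N)%N ->
  0 <= dotg xL xR (- (fourier_diff xL xR N 2 *m V)) V.
Proof.
move=> xLR N0; rewrite dotg_diff2; have h0 := mesh_gt0 xLR N0.
rewrite mulr_ge0 ?(ltW h0)// mulr_ge0 ?invr_ge0 ?ler0n// sumr_ge0// => m _.
by rewrite mulr_ge0 ?wcoef_ge0// mulr_ge0 ?sqr_ge0 ?spectral_ge0.
Qed.

(** The spectral seminorm is equivalent to that of finite differences, uniformly in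
    the mesh: compare the two symbols wave number by wave number. *)
Lemma sqdiff_bounds (V : 'cV[R]_N) : xL < xR -> (0 < N)%N -> ~~ odd N ->
  sqdiff (fun j => V j 0) <= h * dotg xL xR (- (fourier_diff xL xR N 2 *m V)) V
  /\ h * dotg xL xR (- (fourier_diff xL xR N 2 *m V)) V <= 16 / 3 * sqdiff (fun j => V j 0).
Proof.
move=> xLR N0 evenN; rewrite dotg_diff2 sqdiffE//.
have NR : 0 <= N%:R^-1 :> R by rewrite invr_ge0 ler0n.
rewrite [h * _](_ : _ = N%:R^-1 * \sum_(m < N.+1)
    wcoef N m * (h ^+ 2 * kap m ^+ 2 * spectral xL xR (fun j => V j 0) m)); last first.
  rewrite mulrA (mulrCA (h * h)) mulr_sumr; congr (_ * _).
  by apply: eq_bigr => m _; ring.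
have B (m : 'I_N.+1) := symbol_bounds xLR N0 evenN (ltnSE (ltn_ord m)).
split.
  rewrite ler_wpM2l//; apply: ler_sum => m _; have /andP[b1 _] := B m.
  by rewrite ler_wpM2l ?wcoef_ge0// ler_wpM2r ?spectral_ge0.
rewrite [leRHS]mulrCA ler_wpM2l// mulr_sumr; apply: ler_sum => m _.
have /andP[_ b2] := B m.
rewrite [leRHS]mulrCA ler_wpM2l ?wcoef_ge0// [leRHS]mulrA.
by rewrite ler_wpM2r ?spectral_ge0.
Qed.

End Differences.

(** * The scheme conserves energy *)

Section Scheme.
Context {R : realType}.
Variables (xL xR : R) (N : nat).
Local Notation h := (mesh xL xR N).
Local Notation x_ := (node xL xR N).
Local Notation dotg := (dotg xL xR).
Local Notation D1 := (fourier_diff xL xR N 1).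
Local Notation D2 := (fourier_diff xL xR N 2).
Implicit Types (U V W : 'cV[R]_N).

Lemma sqr_sum_le (a : nat -> R) n :
  (\sum_(k < n) a k) ^+ 2 <= n%:R * \sum_(k < n) a k ^+ 2.
Proof.
elim: n => [|n IH]; first by rewrite !big_ord0 mul0r expr0n.
rewrite !big_ord_recr/=; case: n IH => [|n] IH.
  by rewrite !big_ord0 !add0r mul1r.
move: IH (a n.+1); set S := \sum_(k < n.+1) a k; set Q := \sum_(k < n.+1) a k ^+ 2.
move=> IH b; have n0 : 0 < n.+1%:R :> R by rewrite ltr0n.
rewrite -[X in X%:R * _](addn1 n.+1) natrD; move: (n.+1%:R) n0 IH => k k0 IH.
have : k * (2 * S * b) <= k * (Q + k * b ^+ 2).
  by have := sqr_ge0 (S - k * b); rewrite !expr2 => h1; rewrite expr2 in IH; lra.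
rewrite ler_pM2l// => h2; rewrite expr2 in IH; rewrite !expr2 in h2 *; lra.
Qed.

Lemma sqr_path_le (V : 'I_N -> R) (N0 : (0 < N)%N) (j : 'I_N) :
  (V j - V (Ordinal N0)) ^+ 2 <= N%:R * sqdiff V.
Proof.
pose v k := if insub k is Some i then V i else 0.
have vE (i : 'I_N) : v i = V i by rewrite /v valK.
have -> : V j - V (Ordinal N0) = \sum_(k < j) (v k.+1 - v k).
  rewrite -(big_mkord xpredT (fun k => v k.+1 - v k)) telescope_sumr//.
  by rewrite -!vE.
apply: le_trans (sqr_sum_le (fun k => v k.+1 - v k) j) _.
have jN := ltnW (ltn_ord j).
apply: ler_pM => //; first by apply: sumr_ge0 => k _; exact: sqr_ge0.
  by rewrite ler_nat.
rewrite /sqdiff (big_ord_widen_cond N xpredT (fun k => (v k.+1 - v k) ^+ 2))//=.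
rewrite [leRHS](bigID (fun k : 'I_N => (k < j)%N))/= -[leLHS]addr0 lerD//; last first.
  by apply: sumr_ge0 => k _; exact: sqr_ge0.
apply: ler_sum => k kj; rewrite -!vE /= modn_small//.
by rewrite (leq_ltn_trans kj) ?ltn_ord.
Qed.

Lemma dotg_sum V : dotg V V = h * \sum_j V j 0 ^+ 2.
Proof. by congr (_ * _); apply: eq_bigr => j _; rewrite expr2. Qed.

(** The discrete Sobolev inequality: every entry is joined to the first one by a path
    of fewer than N differences, to which the Cauchy-Schwarz inequality applies;
    compare with a second entry in this way, and average over it. *)
Lemma discrete_sup V (j : 'I_N) : xL < xR -> ~~ odd N ->
  V j 0 ^+ 2 <= 2 / (xR - xL) * dotg V V + 8 * (xR - xL) * dotg (- (D2 *m V)) V.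
Proof.
move=> xLR evenN; have N0 : (0 < N)%N by case: N j => [[]|].
have h0 := mesh_gt0 xLR N0; have L0 : 0 < xR - xL by rewrite subr_gt0.
have NR : 0 < N%:R :> R by rewrite ltr0n.
have [lower _] := sqdiff_bounds V xLR N0 evenN.
set J := dotg (- (D2 *m V)) V in lower *.
have NhJ : N%:R * sqdiff (fun j => V j 0) <= (xR - xL) * J.
  have -> : (xR - xL) * J = N%:R * (h * J) by rewrite /mesh; field; rewrite gt_eqF.
  by rewrite ler_pM2l.
have path l : V j 0 ^+ 2 <= 2 * V l 0 ^+ 2 + 8 * ((xR - xL) * J).
  have p1 := le_trans (sqr_path_le (fun j => V j 0) N0 j) NhJ.
  have p2 := le_trans (sqr_path_le (fun j => V j 0) N0 l) NhJ.
  move: p1 p2; move: ((xR - xL) * J) (V (Ordinal N0) 0) (V j 0) (V l 0) => B o y z p1 p2.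
  have := sqr_ge0 (y - z - z); have := sqr_ge0 ((y - o) + (z - o)).
  by rewrite !expr2 in p1 p2 *; lra.
have : \sum_(l < N) V j 0 ^+ 2 <= \sum_(l < N) (2 * V l 0 ^+ 2 + 8 * ((xR - xL) * J)).
  exact: ler_sum.
have cstE (c : R) : \sum_(l < N) c = N%:R * c by rewrite sumr_const card_ord mulr_natl.
rewrite big_split/= -[X in _ <= X + _]mulr_sumr !cstE => H.
rewrite -(ler_pM2l NR); apply: (le_trans H); rewrite dotg_sum.
by rewrite le_eqVlt; apply/orP; left; apply/eqP; rewrite /mesh; field; rewrite !gt_eqF.
Qed.

Lemma dotgC U V : dotg U V = dotg V U.
Proof. by congr (_ * _); apply: eq_bigr => j _; rewrite mulrC. Qed.

Lemma dotgDl U V W : dotg (U + V) W = dotg U W + dotg V W.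
Proof. by rewrite !dotgE linearD/= mulmxDl mxE mulrDr. Qed.

Lemma dotgZl k U W : dotg (k *: U) W = k * dotg U W.
Proof. by rewrite !dotgE linearZ/= -scalemxAl mxE mulrCA. Qed.

Lemma dotgNl U W : dotg (- U) W = - dotg U W.
Proof. by rewrite -scaleN1r dotgZl mulN1r. Qed.

Lemma dotg_adj (B : 'M[R]_N) U V : dotg (B *m U) V = dotg U (B^T *m V).
Proof. by rewrite !dotgE trmx_mul mulmxA. Qed.

Lemma dotg_antisym (B : 'M[R]_N) V : B^T = - B -> dotg (B *m V) V = 0.
Proof.
move=> BT; have : dotg (B *m V) V = - dotg (B *m V) V.
  by rewrite {1}dotg_adj BT mulNmx dotgC dotgNl.
lra.
Qed.

(** This is what the splitting gamma/3 (diag(W) D1 + D1 diag(W)) is designed for: it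
    is antisymmetric for every [W], since [D1] is. *)
Lemma tr_convection a gamma W :
  (convection xL xR a gamma W)^T = - convection xL xR a gamma W.
Proof.
rewrite /convection linearD !linearZ/= linearD/= !trmx_mul tr_diag_mx tr_fourier_diff1.
by rewrite mulNmx mulmxN -opprD !scalerN -opprD [X in _ + gamma / 3 *: X]addrC.
Qed.

Definition denergy (sigma : R) V : R := dotg V V + sigma * dotg (- (D2 *m V)) V.

(** Take the inner product of the scheme with the midpoint (V + U) / 2. Convection
    drops out by antisymmetry, whatever velocity [W] it is linearised at, and the
    symmetry of I - sigma D2 leaves the difference of the two energies. *)
Lemma step_conservation a sigma gamma tau U V W : tau != 0 ->
  (1%:M - sigma *: D2) *m (tau^-1 *: (V - U)) +
  convection xL xR a gamma W *m (2^-1 *: (V + U)) = 0 ->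
  denergy sigma V = denergy sigma U.
Proof.
move=> tau0 E; set A := 1%:M - sigma *: D2 in E.
have AT : A^T = A by rewrite /A linearB linearZ/= trmx1 tr_fourier_diff2.
have AE Z : dotg (A *m Z) Z = denergy sigma Z.
  rewrite /A mulmxBl mul1mx dotgDl -scalemxAl dotgNl dotgZl /denergy dotgNl.
  by rewrite mulrN.
have : dotg (A *m (tau^-1 *: (V - U))) (2^-1 *: (V + U)) = 0.
  have := congr1 (fun Z => dotg Z (2^-1 *: (V + U))) E; rewrite dotgDl.
  rewrite [X in _ + X](dotg_antisym _ (tr_convection _ _ _)) addr0 => ->.
  by rewrite -(scale0r 0) dotgZl mul0r.
rewrite -scalemxAr dotgZl [dotg _ (_ *: _)]dotgC dotgZl => /eqP.
rewrite mulf_eq0 invr_eq0 (negbTE tau0)/= mulf_eq0 invr_eq0 pnatr_eq0/= => /eqP.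
rewrite dotgC mulmxBr dotgDl dotgNl => E2.
have expand Z : dotg Z (V + U) = dotg Z V + dotg Z U by rewrite dotgC dotgDl !(dotgC Z).
have sym : dotg (A *m U) V = dotg (A *m V) U by rewrite dotg_adj AT dotgC.
by move: E2; rewrite !expand !AE sym; lra.
Qed.

End Scheme.

(** * Bounds uniform in time and mesh *)

Section InitialData.
Context {R : realType}.
Variables (xL xR : R) (N : nat).
Local Notation h := (mesh xL xR N).
Local Notation x_ := (node xL xR N).
Local Notation D := (weak_derivative xL xR).

Lemma node_le j : xL < xR -> (0 < N)%N -> (j <= N)%N -> xL <= x_ j <= xR.
Proof.
move=> xLR N0 jN; have h0 := mesh_gt0 xLR N0.
have xRE : xR = xL + N%:R * h.
  by rewrite /mesh mulrC divfK ?pnatr_eq0 -?lt0n//; ring.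
have jN' : j%:R <= N%:R :> R by rewrite ler_nat.
rewrite /node lerDl mulr_ge0 ?(ltW h0)//= [leRHS]xRE lerD2l.
by rewrite ler_wpM2r// ltW.
Qed.

Lemma node0 : x_ 0 = xL. Proof. by rewrite /node mul0r addr0. Qed.

Lemma nodeN : (0 < N)%N -> x_ N = xR.
Proof.
by move=> N0; rewrite /node /mesh mulrC divfK ?pnatr_eq0 -?lt0n//; ring.
Qed.

Lemma nodeS j : x_ j.+1 = x_ j + h.
Proof. by rewrite /node -natr1; ring. Qed.

Lemma sint_nodes (g : R -> R) n : xL < xR -> (0 < N)%N -> (n <= N)%N -> locint g ->
  \sum_(j < n) sint g (x_ j) (x_ j.+1) = sint g xL (x_ n).
Proof.
move=> xLR N0 nN lg; elim: n nN => [|n IH] nN.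
  by rewrite big_ord0 node0 sint_point.
rewrite big_ord_recr/= IH; last exact: ltnW.
have /andP[h1 _] := node_le xLR N0 (ltnW nN).
by rewrite -sint_split// nodeS lerDl ltW// mesh_gt0.
Qed.

(** Each difference is the integral of the derivative over one cell: apply the
    Cauchy-Schwarz inequality there and add up the cells. *)
Lemma sqdiff_sample f : xL < xR -> (0 < N)%N -> H1p xL xR f ->
  sqdiff (fun j : 'I_N => f (x_ j)) <= h * sint (fun x => D f x ^+ 2) xL xR.
Proof.
move=> xLR N0 fH; have [DL _] := weak_derivativeP fH; have [_ [_ pf _] _] := fH.
have lD := L2p_locint2 xLR DL; have h0 := mesh_gt0 xLR N0.
have := sint_nodes xLR N0 (leqnn N) lD; rewrite nodeN// => <-; rewrite mulr_sumr.
apply: ler_sum => j _.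
have -> : f (x_ (ordS j)) = f (x_ j.+1).
  have jN := ltn_ord j; have [jl|jl] := ltnP j.+1 N; first by rewrite /= modn_small.
  have -> : j.+1 = N by apply/eqP; rewrite eqn_leq jl jN.
  rewrite /= (_ : j.+1 = N) ?modnn ?node0 ?nodeN//; last by apply/eqP; rewrite eqn_leq jl jN.
  by rewrite (periodic_end pf).
have xx : x_ j <= x_ j.+1 by rewrite nodeS lerDl ltW.
apply: le_trans (sqr_increment_le xLR fH _ _ xx) _.
- by apply: node_le => //; exact: ltnW.
- exact: node_le.
- by rewrite nodeS addrC addKr.
Qed.

End InitialData.

Lemma le_sqr1D (R : realType) (S : R) : 0 <= S -> S <= (1 + S) ^+ 2.
Proof. by move=> S0; have := sqr_ge0 S; rewrite !expr2; lra. Qed.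

Lemma bound_of_sqr (R : realType) (x S : R) : 0 <= S -> x ^+ 2 <= S -> `|x| <= 1 + S.
Proof.
move=> S0 xS; rewrite -(@ler_pXn2r _ 2)// ?nnegrE//; last by rewrite addr_ge0.
by rewrite real_normK ?num_real// (le_trans xS)// le_sqr1D.
Qed.

Lemma bound_of_sqrt (R : realType) (x S : R) : 0 <= S -> x <= S -> Num.sqrt x <= 1 + S.
Proof.
move=> S0 xS; have [x0|x0] := leP 0 x; last first.
  by rewrite ler0_sqrtr ?addr_ge0// ltW.
rewrite -(ger0_norm (sqrtr_ge0 x)); apply: bound_of_sqr => //.
by rewrite sqr_sqrtr.
Qed.

Section Bounds.
Context {R : realType}.
Variables (xL xR sigma : R).
Hypotheses (xLR : xL < xR) (s0 : 0 < sigma).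
Local Notation D := (weak_derivative xL xR).

Lemma exact_bounds (e S : R) (f : R -> R) : H1p xL xR f ->
  energy xL xR sigma f = e ->
  e <= S -> e / sigma <= S ->
  2 / (xR - xL) * e + 2 * (xR - xL) * (e / sigma) <= S ->
  [/\ (L2norm xL xR f <= (1 + S)%:E)%E,
      (L2norm xL xR (D f) <= (1 + S)%:E)%E &
      (Linfnorm xL xR f <= (1 + S)%:E)%E].
Proof.
move=> fH eE e1 e2 e3; have [DL _] := weak_derivativeP fH; have [_ fL _] := fH.
have L0 : 0 < xR - xL by rewrite subr_gt0.
pose A := sint (fun x => f x ^+ 2) xL xR; pose B := sint (fun x => D f x ^+ 2) xL xR.
have A0 : 0 <= A by apply: sint_ge0 => x; exact: sqr_ge0.
have B0 : 0 <= B by apply: sint_ge0 => x; exact: sqr_ge0.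
have AB : A + sigma * B = e by [].
have Ae : A <= e by rewrite -AB lerDl mulr_ge0// ltW.
have Be : B <= e / sigma by rewrite ler_pdivlMr// -AB [B * _]mulrC lerDr.
have S0 : 0 <= S by rewrite (le_trans _ e1)// (le_trans _ Ae).
have sq (x : R) : x <= S -> x <= (1 + S) ^+ 2.
  by move=> xS; apply: le_trans xS (le_sqr1D S0).
have S10 : 0 <= 1 + S by rewrite addr_ge0.
split.
- by apply: L2norm_le => //; apply: sq; exact: le_trans e1.
- by apply: L2norm_le => //; apply: sq; exact: le_trans e2.
- apply: Linfnorm_le => // x xin; apply: bound_of_sqr => //.
  apply: le_trans (H1p_sup xLR fH xin) _; apply: le_trans e3; apply: lerD.
    by rewrite ler_wpM2l// divr_ge0// ltW.
  by rewrite ler_wpM2l// mulr_ge0// ltW.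
Qed.

Lemma discrete_bounds (N : nat) (e S : R) (V : 'cV[R]_N) : ~~ odd N -> (0 < N)%N ->
  denergy xL xR sigma V <= e -> 0 <= S ->
  e <= S -> e / sigma <= S ->
  2 / (xR - xL) * e + 8 * (xR - xL) * (e / sigma) <= S ->
  [/\ normg xL xR V <= 1 + S, seminormg xL xR V <= 1 + S & normg_inf V <= 1 + S].
Proof.
move=> evenN N0 eE S0 e1 e2 e3.
have L0 : 0 < xR - xL by rewrite subr_gt0.
have B0 := seminorm_sqr V xLR N0.
have A0 : 0 <= dotg xL xR V V.
  rewrite dotg_sum mulr_ge0 ?(ltW (mesh_gt0 xLR N0))//.
  by apply: sumr_ge0 => j _; exact: sqr_ge0.
move: eE; rewrite /denergy => eE.
have Ae : dotg xL xR V V <= e by rewrite (le_trans _ eE)// lerDl mulr_ge0// ltW.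
have Be : dotg xL xR (- (fourier_diff xL xR N 2 *m V)) V <= e / sigma.
  by rewrite ler_pdivlMr// (le_trans _ eE)// [X in X <= _]mulrC lerDr.
split.
- by apply: bound_of_sqrt => //; exact: le_trans e1.
- by apply: bound_of_sqrt => //; exact: le_trans e2.
- apply: bigmax_le => [|j _]; first by rewrite addr_ge0.
  apply: bound_of_sqr => //; apply: le_trans (discrete_sup V j xLR evenN) _.
  apply: le_trans e3; apply: lerD.
    by rewrite ler_wpM2l// divr_ge0// ltW.
  by rewrite ler_wpM2l// mulr_ge0// ltW.
Qed.

(** The initial data are only interpolated, but the spectral seminorm of the
    interpolant is controlled by its finite differences, hence by the derivative. *)
Lemma initial_energy (N : nat) (f : R -> R) (K : R) : ~~ odd N -> (0 < N)%N ->
  H1p xL xR f -> (forall x, xL <= x <= xR -> f x ^+ 2 <= K) ->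
  denergy xL xR sigma (\col_(j < N) f (node xL xR N j)) <=
  (xR - xL) * K + sigma * (16 / 3 * sint (fun x => D f x ^+ 2) xL xR).
Proof.
move=> evenN N0 fH fK; rewrite /denergy; set V := \col_(j < N) _.
have h0 := mesh_gt0 xLR N0 : 0 < mesh xL xR N.
have [_ upper] := sqdiff_bounds V xLR N0 evenN.
have sE : sqdiff (fun j : 'I_N => V j 0) = sqdiff (fun j : 'I_N => f (node xL xR N j)).
  by apply: eq_bigr => j _; rewrite !mxE.
apply: lerD.
  have NR : N%:R != 0 :> R by rewrite pnatr_eq0 -lt0n.
  rewrite dotg_sum (_ : (xR - xL) * K = mesh xL xR N * (N%:R * K)); last first.
    by rewrite /mesh; field.
  rewrite ler_wpM2l ?(ltW h0)//.
  apply: (@le_trans _ _ (\sum_(j < N) K)); last by rewrite sumr_const card_ord mulr_natl.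
  by apply: ler_sum => j _; rewrite mxE fK// node_le// ltnW.
rewrite ler_wpM2l ?(ltW s0)// -(ler_pM2l h0) (le_trans upper)// sE.
by rewrite [leRHS]mulrCA ler_wpM2l// ?sqdiff_sample//; lra.
Qed.

End Bounds.

Lemma initial_level_ge0 (R : realType) (L sigma I J : R) :
  0 < L -> 0 < sigma -> 0 <= I -> 0 <= J ->
  0 <= L * (2 / L * I + 2 * L * J) + sigma * (16 / 3 * J).
Proof.
move=> L0 s0 I0 J0; have sJ := mulr_ge0 (ltW s0) J0; have LJ := mulr_ge0 (ltW L0) J0.
have -> : L * (2 / L * I + 2 * L * J) = 2 * I + 2 * (L * (L * J)).
  by field; rewrite gt_eqF.
have := mulr_ge0 (ltW L0) LJ; lra.
Qed.

Lemma uniform_constant (R : realType) (L sigma e1 e2 : R) :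
  0 < L -> 0 < sigma -> 0 <= e1 -> 0 <= e2 ->
  exists S, [/\ 0 <= S,
    [/\ e1 <= S, e1 / sigma <= S & 2 / L * e1 + 2 * L * (e1 / sigma) <= S] &
    [/\ e2 <= S, e2 / sigma <= S & 2 / L * e2 + 8 * L * (e2 / sigma) <= S]].
Proof.
move=> L0 s0 e10 e20.
have p1 : 0 <= e1 / sigma by rewrite divr_ge0// ltW.
have p2 : 0 <= e2 / sigma by rewrite divr_ge0// ltW.
have q1 : 0 <= 2 / L * e1 + 2 * L * (e1 / sigma).
  by rewrite addr_ge0// mulr_ge0// ?divr_ge0// ?mulr_ge0// ltW.
have q2 : 0 <= 2 / L * e2 + 8 * L * (e2 / sigma).
  by rewrite addr_ge0// mulr_ge0// ?divr_ge0// ?mulr_ge0// ltW.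
move: (e1 / sigma) (e2 / sigma) (2 / L * e1 + _) (2 / L * e2 + _) p1 p2 q1 q2.
move=> s1 s2 t1 t2 p1 p2 q1 q2.
by exists (e1 + e2 + s1 + s2 + t1 + t2); split; [|split..]; lra.
Qed.

Theorem theorem4p1 (R : realType) (a sigma gamma T xL xR : R)
    (a_gt0 : 0 < a) (sigma_gt0 : 0 < sigma) (gamma_gt0 : 0 < gamma)
    (T_gt0 : 0 < T) (xL_lt_xR : xL < xR)
    (u0 : R -> R) (u0_H1p : H1p xL xR u0) :
  exists2 C : R, 0 < C &
    (forall u : R -> R -> R,
       RLW_exact_solution xL xR a sigma gamma T u0 u ->
       forall t : R, t \in `[0, T] ->
         [/\ (L2norm xL xR (u t) <= C%:E)%E,
             (L2norm xL xR (weak_derivative xL xR (u t)) <= C%:E)%E &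
             (Linfnorm xL xR (u t) <= C%:E)%E]) /\
    (forall (N Nt : nat) (U : nat -> 'cV[R]_N),
       (0 < N)%N -> ~~ odd N -> (0 < Nt)%N ->
       LCN_MP_solution xL xR a sigma gamma T Nt u0 U ->
       forall n : nat, (n <= Nt)%N ->
         [/\ normg xL xR (U n) <= C,
             seminormg xL xR (U n) <= C &
             normg_inf (U n) <= C]).
Proof.
have L0 : 0 < xR - xL by rewrite subr_gt0.
pose J : R := sint (fun x => weak_derivative xL xR u0 x ^+ 2) xL xR.
pose I0 : R := sint (fun x => u0 x ^+ 2) xL xR.
pose K : R := 2 / (xR - xL) * I0 + 2 * (xR - xL) * J.
have J0 : 0 <= J by apply: sint_ge0 => x; exact: sqr_ge0.
have I00 : 0 <= I0 by apply: sint_ge0 => x; exact: sqr_ge0.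
have K_bound x : xL <= x <= xR -> u0 x ^+ 2 <= K by exact: H1p_sup.
have e10 : 0 <= energy xL xR sigma u0 by apply: energy_ge0; exact: ltW.
have e20 := initial_level_ge0 L0 sigma_gt0 I00 J0.
have [S [S0 [s1 s2 s3] [d1 d2 d3]]] := uniform_constant L0 sigma_gt0 e10 e20.
exists (1 + S); first by rewrite ltr_wpDr.
split=> [u uS t tT|N Nt U N0 evenN Nt0 [U0 first_step next_steps] n nNt].
  have [uH uE] := energy_conservation xL_lt_xR T_gt0 sigma_gt0 uS tT.
  exact: (exact_bounds xL_lt_xR sigma_gt0 uH uE s1 s2 s3).
have tau0 : T / Nt%:R != 0 by rewrite gt_eqF// divr_gt0// ltr0n.
have conserved k : (k <= Nt)%N ->
    denergy xL xR sigma (U k) = denergy xL xR sigma (U 0%N).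
  elim: k => [//|k IH] kNt; rewrite -IH; last exact: ltnW.
  case: k kNt {IH} => [|k] kNt; first exact: step_conservation tau0 first_step.
  by apply: step_conservation tau0 (next_steps k.+1 _); rewrite kNt.
apply: (discrete_bounds xL_lt_xR sigma_gt0 evenN N0 _ S0 d1 d2 d3).
rewrite conserved// U0.
exact: (initial_energy xL_lt_xR sigma_gt0 evenN N0 u0_H1p K_bound).
Qed.
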